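(* Fix $n$ and $\tau\in\mathcal A_n$. Let $h,\psi:[0,\infty)\to[0,\infty)$ be continuous monotonically increasing functions with $h(0)=\psi(0)=0$ such that $h$ is concave and $t\mapsto\psi'(t)/t$ is a non-constant completely monotone function on $(0,\infty)$. Suppose that for each dimension $d$, $Z_1,\ldots,Z_\tau\stackrel{iid}{\sim}F_1$ and, independently, $Z_{\tau+1},\ldots,Z_n\stackrel{iid}{\sim}F_2$, where $F_1=F_{1,d}$ and $F_2=F_{2,d}$ are distributions on $\mathbb{R}^d$ satisfying: (A4) for all $r,s\in\{1,2\}$, if $Z\sim F_r$ and $Z_*\sim F_s$ are independent and $W=Z-Z_*$, then (i) the variables $\psi(|W^{(q)}|)$ have uniformly bounded second moments, and (ii) $\sum_{q\ne q'}\big|\mathrm{Corr}\big(\psi(|W^{(q)}|),\psi(|W^{(q')}|)\big)\big|=o(d^2)$ as $d\to\infty$. Assume also that $\lim_{d\to\infty}\mathcal E^{(d)}_{h,\psi}(F_1,F_2)>0$. Then: (a) $\mathbb{P}(\widehat T_n^{h,\psi}=\tau)\to1$ as $d\to\infty$. (b) Let $\alpha\in(0,1)$. If $|\mathcal B(\rho_{n,\tau})|/n!\le\alpha$, then the change-point $\tau$ is detected (by $\widehat T_n^{h,\psi}$) at level $\alpha$ with probability converging to one, i.e. $\mathbb{P}(\widehat T^{h,\psi}_n=\tau,\ \widehat S^{h,\psi}_n>\widehat c_{1-\alpha})\to1$ as $d\to\infty$.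
   Context: For $x,y\in\mathbb{R}^d$, $\varphi_{h,\psi}(x,y)=h\big\{\frac1d\sum_{k=1}^d\psi(|x^{(k)}-y^{(k)}|)\big\}$, where $x^{(k)}$ denotes the $k$-th coordinate. For independent $Z\sim F_r$, $Z_*\sim F_s$, $\phi^*_{h,\psi}(F_r,F_s)=h\big(\frac1d\sum_{q=1}^d\mathbb{E}\psi(|Z^{(q)}-Z_*^{(q)}|)\big)$, and $\mathcal E^{(d)}_{h,\psi}(F_1,F_2)=2\phi^*_{h,\psi}(F_1,F_2)-\phi^*_{h,\psi}(F_1,F_1)-\phi^*_{h,\psi}(F_2,F_2)$. For $2\le t\le n-2$ define $$T^{h,\psi}_{11}(t)=\binom t2^{-1}\sum_{1\le i<j\le t}\varphi_{h,\psi}(Z_i,Z_j),\quad T^{h,\psi}_{22}(t)=\binom{n-t}2^{-1}\sum_{t+1\le i<j\le n}\varphi_{h,\psi}(Z_i,Z_j),$$ $$T^{h,\psi}_{12}(t)=\frac1{t(n-t)}\sum_{i=1}^{t}\sum_{j=t+1}^{n}\varphi_{h,\psi}(Z_i,Z_j),$$ $\mathcal D^{h,\psi}_n(t)=\{T^{h,\psi}_{12}(t)-T^{h,\psi}_{11}(t)\}^2+\{T^{h,\psi}_{12}(t)-T^{h,\psi}_{22}(t)\}^2$, and $w(t)=t(n-t)/n^2$. With $\delta_n\in(0,1/2)$ and $m=\lfloor n\delta_n\rfloor$ (usual floor, $m\ge2$ so that everything is defined), $\mathcal A_n=\{m,m+1,\ldots,n-m\}$. Define $\widehat S^{h,\psi}_n=\max_{t\in\mathcal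 A_n}w(t)\mathcal D^{h,\psi}_n(t)$ and $\widehat T^{h,\psi}_n\in\operatorname{argmax}_{t\in\mathcal A_n}w(t)\mathcal D^{h,\psi}_n(t)$. Permutation test: for a permutation $\pi$ of $\{1,\ldots,n\}$ let $\widehat S_n^{h,\psi,(\pi)}$ be $\widehat S^{h,\psi}_n$ computed from $Z_{\pi(1)},\ldots,Z_{\pi(n)}$, and $\widehat c_{1-\alpha}=\inf\{x\ge 0:\frac1{n!}\sum_\pi \mathbf 1[\widehat S_n^{h,\psi,(\pi)}\le x]\ge1-\alpha\}$. The potential change-point $\widehat T_n^{h,\psi}$ is a detected change-point at level $\alpha$ if $\widehat S^{h,\psi}_n>\widehat c_{1-\alpha}$. Unbalanced permutations: for a permutation $\pi$ and $t\in\mathcal A_n$ let $k_\pi(t)=\#\{i\le t:\pi(i)\le\tau\}$, $p_\pi(t)=k_\pi(t)/t$, $q_\pi(t)=(\tau-k_\pi(t))/(n-t)$. Define $$\rho_{n,\tau}=-2\frac{w(m)}{m-1}+\sqrt{4\Big(\frac{w(m)}{m-1}\Big)^2+2\Big\{w(\tau)-\frac{w(m)}{2(m-1)^2}\Big\}},$$ $\mathcal B(\rho_{n,\tau})=\{\pi:\max_{t\in\mathcal A_n}|p_\pi(t)-q_\pi(t)|>\rho_{n,\tau}\}$. *)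

(* Defs.v *)
From HB Require Import structures.
From mathcomp Require Import all_boot all_order all_algebra perm.
From mathcomp Require Import all_classical all_reals all_analysis.

Set Implicit Arguments.
Unset Strict Implicit.
Unset Printing Implicit Defensive.

Import Order.TTheory GRing.Theory Num.Theory.
Import numFieldNormedType.Exports.

Local Open Scope classical_set_scope.
Local Open Scope ring_scope.

(* Functions on [0, oo) are represented by functions R -> R of which only the
   restriction to [0, oo) is ever used.  Points of R^d are tuples, with the
   product sigma-algebra; d = 0 (a one-point space) carries no information. *)

Definition concave_on {R : realType} (D : set R) (f : R -> R) : Prop :=
  @convex_function R R^o D (fun x => - f x).

(* Only derivatives at points of (0, oo) matter; the explicit derivability
   clause is needed because derive1 is total. *)
Definition completely_monotone {R : realType} (f : R -> R) : Prop :=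
  forall (k : nat) (x : R), 0 < x ->
    derivable (derive1n k f) x 1 /\ 0 <= (- 1) ^+ k * derive1n k f x.

Definition admissible {R : realType} (h psi : R -> R) : Prop :=
  [/\ [/\ {within `[0, +oo[, continuous h}, h 0 = 0,
          {in `[0, +oo[, forall x, 0 <= h x} &
          {in `[0, +oo[ &, {homo h : x y / x <= y}}],
      [/\ {within `[0, +oo[, continuous psi}, psi 0 = 0,
          {in `[0, +oo[, forall x, 0 <= psi x} &
          {in `[0, +oo[ &, {homo psi : x y / x <= y}}],
      concave_on `[0, +oo[ h &
      [/\ forall t : R, 0 < t -> derivable psi t 1,
          completely_monotone (fun t => derive1 psi t / t) &
          ~ exists c : R, forall t : R, 0 < t -> derive1 psi t / t = c] ].

Section Population.
Context {R : realType}.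
Variables (h psi : R -> R) (d : nat).

Definition dissim (x y : d.-tuple R) : R :=
  h (d%:R^-1 * \sum_(k < d) psi `|tnth x k - tnth y k|).

(* psi(|W^(q)|) with W = Z - Z_*, as a function of the pair (Z, Z_* ). *)
Definition psi_coord (q : 'I_d) (z : d.-tuple R * d.-tuple R) : R :=
  psi `|tnth z.1 q - tnth z.2 q|.

(* An independent pair Z ~ F, Z_* ~ G is realised on the product space, with
   law F \x G. *)
Definition pop_dissim (F G : probability (d.-tuple R) R) : R :=
  h (d%:R^-1 * \sum_(q < d) fine 'E_(F \x G)[psi_coord q]%E).

Definition energy (F1 F2 : probability (d.-tuple R) R) : R :=
  2 * pop_dissim F1 F2 - pop_dissim F1 F1 - pop_dissim F2 F2.

End Population.

(* Equal to 0 when one of the variances vanishes. *)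
Definition correlation {disp} {T : measurableType disp} {R : realType}
    (P : probability T R) (X Y : T -> R) : R :=
  fine (covariance P X Y) / Num.sqrt (fine 'V_P[X] * fine 'V_P[Y]).

Definition A4_pair {R : realType} (psi : R -> R)
    (F G : forall d, probability (d.-tuple R) R) : Prop :=
  (exists C : R, forall (d : nat) (q : 'I_d),
     ('E_(F d \x G d)[(fun z => psi_coord psi q z ^+ 2)%R] <= C%:E)%E) /\
  (fun d : nat => \sum_(q < d) \sum_(q' < d | q != q')
     `|correlation (F d \x G d)%E (psi_coord psi q) (psi_coord psi q')|)
    =o_\oo (fun d : nat => d%:R ^+ 2 : R).

Definition A4 {R : realType} (psi : R -> R)
    (F1 F2 : forall d, probability (d.-tuple R) R) : Prop :=
  [/\ A4_pair psi F1 F1, A4_pair psi F1 F2,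
      A4_pair psi F2 F1 & A4_pair psi F2 F2].

Definition mutually_independent {disp disp'} {T : measurableType disp}
    {U : measurableType disp'} {R : realType} (P : probability T R)
    (n : nat) (X : 'I_n -> {RV P >-> U}) : Prop :=
  forall (J : {set 'I_n}) (A : 'I_n -> set U), (forall i, measurable (A i)) ->
    fine (P (\bigcap_(i in [set` J]) X i @^-1` A i)) =
    \prod_(i in J) fine (P (X i @^-1` A i)).

(* Observations are indexed by 'I_n from 0: the first t observations
   Z_1, ..., Z_t are the z i with i < t. *)
Section Scan.
Context {R : realType}.
Variables (h psi : R -> R) (n d : nat).
Implicit Type z : 'I_n -> d.-tuple R.

Definition T11 z (t : nat) : R :=
  'C(t, 2)%:R^-1 * \sum_(i < n) \sum_(j < n | (i < j < t)%N)
    dissim h psi (z i) (z j).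

Definition T22 z (t : nat) : R :=
  'C(n - t, 2)%:R^-1 * \sum_(i < n) \sum_(j < n | (t <= i < j)%N)
    dissim h psi (z i) (z j).

Definition T12 z (t : nat) : R :=
  (t * (n - t))%:R^-1 * \sum_(i < n | (i < t)%N) \sum_(j < n | (t <= j)%N)
    dissim h psi (z i) (z j).

Definition Dn z (t : nat) : R :=
  (T12 z t - T11 z t) ^+ 2 + (T12 z t - T22 z t) ^+ 2.

End Scan.

Definition weight {R : realType} (n t : nat) : R :=
  (t * (n - t))%:R / n%:R ^+ 2.

Definition in_range (n m t : nat) : bool := (m <= t <= n - m)%N.

(* All terms are nonnegative, so starting the maximum at 0 is harmless. *)
Definition Sn {R : realType} (h psi : R -> R) (n m d : nat)
    (z : 'I_n -> d.-tuple R) : R :=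
  \big[Num.max/0]_(m <= t < (n - m).+1) (weight n t * Dn h psi z t).

Definition is_argmax {R : realType} (h psi : R -> R) (n m d : nat)
    (z : 'I_n -> d.-tuple R) (t : nat) : Prop :=
  in_range n m t /\
  forall s : nat, in_range n m s ->
    weight n s * Dn h psi z s <= weight n t * Dn h psi z t.

Definition perm_quantile {R : realType} (h psi : R -> R) (n m d : nat)
    (alpha : R) (z : 'I_n -> d.-tuple R) : R :=
  inf [set x : R | 0 <= x /\
    1 - alpha <= n`!%:R^-1 *
      \sum_(p : 'S_n) (Sn h psi m (fun i => z (p i)) <= x)%R%:R].

Section Unbalanced.
Context {R : realType}.
Variables n m tau : nat.

Definition kperm (p : 'S_n) (t : nat) : nat :=
  #|[pred i : 'I_n | (i < t)%N && (p i < tau)%N]|.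

Definition pperm (p : 'S_n) (t : nat) : R := (kperm p t)%:R / t%:R.

Definition qperm (p : 'S_n) (t : nat) : R :=
  (tau%:R - (kperm p t)%:R) / (n - t)%:R.

Definition rho : R :=
  let wm := weight n m in
  - 2 * (wm / (m%:R - 1)) +
  Num.sqrt (4 * (wm / (m%:R - 1)) ^+ 2 +
            2 * (weight n tau - wm / (2 * (m%:R - 1) ^+ 2))).

Definition Bset (r : R) : {set 'S_n} :=
  [set p : 'S_n |
    r < \big[Num.max/0]_(m <= t < (n - m).+1) `|pperm p t - qperm p t|]%SET.

End Unbalanced.

(* Main.v *)
(* Every pairwise dissimilarity concentrates, as d grows, around one of three
   population values f11, f12, f22 (Chebyshev, using (A4), and the modulus of
   continuity |h x - h y| <= h |x - y| given by concavity).  On the noise-free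
   matrix of population values put a = f12 - f11, b = f12 - f22, e = a + b, and
   let p and q be the fractions of F_1 observations before and after t.  The two
   differences entering D_n(t) are then
     (q - p)((1 - p) b - p a) - p (1 - p) e / (t - 1)
   and the same expression with p, q exchanged and n - t in place of t.  Hence
   w D at t <> tau is at most (1 - 1/n) times its value w(tau)(a^2 + b^2) at tau,
   and a permutation with |p - q| <= rho at every t only reaches a fixed fraction
   of that value, because rho solves
     rho^2/2 + 2 rho w(m)/(m-1) + w(m)/(2 (m-1)^2) = w(tau).
   Both separations are relative and a^2 + b^2 >= e^2/2 stays away from 0, so they
   survive a small perturbation of the matrix. *)

Require Import Defs.
From HB Require Import structures.
From mathcomp Require Import all_boot all_order all_algebra perm.
From mathcomp Require Import ring lra zify.
From mathcomp Require Import all_classical all_reals all_analysis measurable_realfun.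

Set Implicit Arguments.
Unset Strict Implicit.
Unset Printing Implicit Defensive.

Import Order.TTheory GRing.Theory Num.Theory.
Import numFieldNormedType.Exports.

Local Open Scope classical_set_scope.
Local Open Scope ring_scope.

(** * Gaps between population averages *)

Section Gap.
Context {R : realFieldType}.
Implicit Types a b p q x y T N K e r : R.

(* T12 - T11 on population values, for T observations of which a fraction p
   comes from F_1, against a second sample with fraction q; the last term comes
   from excluding the pairs i = j. *)
Definition gap a b p q T : R :=
  (q - p) * ((1 - p) * b - p * a) - p * (1 - p) * (a + b) / (T - 1).

(** Exchanges the roles of F_1 and F_2, so that the bound for a split before the change point also
    serves a split after it. *)
Lemma gap_swap a b p q T : gap a b p q T = gap b a (1 - p) (1 - q) T.
Proof. by rewrite /gap; congr (_ - _); [ring | rewrite (addrC b); congr (_ / _); ring]. Qed.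

(** One sample is pure; the other, of size N = M + s, contains [s] misplaced observations. With k =
    M/N and l = (M-1)/(N-1) the gaps are k a and k (l b - (1-l) a). Convexity of the square reduces
    the claim to k l <= 1 and k (2-l) <= 1, and 1 - k (2-l) = s(s-1)/(N(N-1)), whence the condition
    [1 <= s]. *)
Lemma gap_pure a b M s T : 2 <= M -> 1 <= s ->
  (M + s) * (gap a b 1 (s / (M + s)) T ^+ 2 +
             gap a b (s / (M + s)) 1 (M + s) ^+ 2) <= M * (a ^+ 2 + b ^+ 2).
Proof.
move=> M2 s1.
have N0 : M + s != 0 by apply/lt0r_neq0; lra.
have N1 : M + s - 1 != 0 by apply/lt0r_neq0; lra.
set N := M + s in N0 N1 *.
have -> : gap a b 1 (s / N) T = - (M / N) * - a.
  rewrite /gap subrr mulr0 !mul0r subr0 sub0r mul1r.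
  by have -> : M = N - s; [rewrite /N addrK | field].
have -> : gap a b (s / N) 1 N = M / N * ((M - 1) / (N - 1) * b - s / (N - 1) * a).
  rewrite /gap; have -> : M = N - s by rewrite /N addrK.
  by field; rewrite N0 N1.
have l0 : 0 <= (M - 1) / (N - 1) by apply: divr_ge0; rewrite /N; lra.
have s0 : 0 <= s / (N - 1) by apply: divr_ge0; rewrite /N; lra.
have sE : s / (N - 1) = 1 - (M - 1) / (N - 1).
  by rewrite /N in N1 *; field.
have mE : M / N * (2 - (M - 1) / (N - 1)) <= 1.
  rewrite -subr_ge0.
  have -> : 1 - M / N * (2 - (M - 1) / (N - 1)) = s * (s - 1) / (N * (N - 1)).
    by rewrite /N in N0 N1 *; field; rewrite N0 N1.
  by apply: divr_ge0; apply: mulr_ge0; rewrite /N; lra.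
have mN : 0 <= M / N <= 1.
  apply/andP; split; first by apply: divr_ge0; rewrite /N; lra.
  by rewrite ler_pdivrMr ?mul1r /N; lra.
set l := (M - 1) / (N - 1) in l0 sE mE *.
rewrite sE in s0 *.
set k := M / N in mE mN *.
have -> : M = N * k by rewrite /k mulrC divfK.
have Nge0 : 0 <= N by rewrite /N; lra.
rewrite -[leRHS]mulrA ler_wpM2l//.
have /andP[k0 k1] := mN.
have cvx : (l * b - (1 - l) * a) ^+ 2 <= l * b ^+ 2 + (1 - l) * a ^+ 2.
  rewrite -subr_ge0.
  have -> : l * b ^+ 2 + (1 - l) * a ^+ 2 - (l * b - (1 - l) * a) ^+ 2 =
    l * (1 - l) * (a + b) ^+ 2 by ring.
  by rewrite mulr_ge0 ?sqr_ge0// mulr_ge0.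
have -> : (- k * - a) ^+ 2 + (k * (l * b - (1 - l) * a)) ^+ 2 =
  k * (k * (a ^+ 2 + (l * b - (1 - l) * a) ^+ 2)) by ring.
rewrite ler_wpM2l//.
apply: (@le_trans _ _ (k * ((2 - l) * a ^+ 2 + l * b ^+ 2))).
  by rewrite ler_wpM2l//; move: cvx; set u := _ ^+ 2; lra.
have -> : k * ((2 - l) * a ^+ 2 + l * b ^+ 2) =
  (k * (2 - l)) * a ^+ 2 + (k * l) * b ^+ 2 by ring.
apply: lerD; rewrite ler_piMl ?sqr_ge0//.
by rewrite mulr_ile1//; lra.
Qed.

Lemma sqrD_le a b : (a + b) ^+ 2 <= 2 * (a ^+ 2 + b ^+ 2).
Proof.
rewrite -subr_ge0.
have -> : 2 * (a ^+ 2 + b ^+ 2) - (a + b) ^+ 2 = (a - b) ^+ 2 by ring.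
exact: sqr_ge0.
Qed.

Lemma sqr_convex_le a b p : 0 <= p <= 1 ->
  ((1 - p) * b - p * a) ^+ 2 <= a ^+ 2 + b ^+ 2.
Proof.
move=> /andP[p0 p1]; rewrite -subr_ge0.
have -> : a ^+ 2 + b ^+ 2 - ((1 - p) * b - p * a) ^+ 2 =
  p * (1 - p) * (a + b) ^+ 2 + (1 - p) * a ^+ 2 + p * b ^+ 2 by ring.
have p0' : 0 <= 1 - p by lra.
by rewrite !addr_ge0 // mulr_ge0 ?sqr_ge0 // mulr_ge0.
Qed.

(* With x = (q - p) u the signal part of a gap and y = p(1-p)e/(T-1) its
   finite sample correction, (x - y)^2 <= x^2 + 2|x||y| + y^2 where
   |u| <= K, |e| <= 2K and p(1-p) <= 1/4. *)
Lemma sqr_gap_le a b p q T r w c g K : 0 <= p <= 1 -> 1 < T ->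
  0 <= w <= 4^-1 -> `|p - q| <= r -> a ^+ 2 + b ^+ 2 <= K ^+ 2 -> 0 <= K ->
  w / (T - 1) <= c -> w / (T - 1) ^+ 2 <= g ->
  w * gap a b p q T ^+ 2 <= (r ^+ 2 / 4 + r * c + g / 8) * K ^+ 2.
Proof.
move=> p01 T1 /andP[w0 w4] pqr abK K0 wc wg.
have r0 : 0 <= r by apply: le_trans pqr.
have T10 : 0 < T - 1 by lra.
pose u := (1 - p) * b - p * a.
have uK2 : u ^+ 2 <= K ^+ 2 by apply: le_trans abK; exact: sqr_convex_le.
have uK : `|u| <= K by rewrite -(ler_pXn2r (n:=2))// ?nnegrE// real_normK ?num_real.
have eK2 : (a + b) ^+ 2 <= 2 * K ^+ 2.
  by apply: (le_trans (sqrD_le a b)); rewrite ler_pM2l.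
have eK : `|a + b| <= 2 * K.
  rewrite -(ler_pXn2r (n:=2))// ?nnegrE ?mulr_ge0// real_normK ?num_real//.
  apply: (le_trans eK2); rewrite exprMn ler_wpM2r ?sqr_ge0//; lra.
have pp0 : 0 <= p * (1 - p) by case/andP: p01 => ? ?; rewrite mulr_ge0//; lra.
have pp4 : p * (1 - p) <= 4^-1.
  rewrite -subr_ge0; have -> : 4^-1 - p * (1 - p) = (p - 2^-1) ^+ 2 by field.
  exact: sqr_ge0.
pose s := (q - p) * u; pose v := p * (1 - p) * (a + b).
have -> : w * gap a b p q T ^+ 2 =
  w * s ^+ 2 - 2 * (w / (T - 1)) * (s * v) + w / (T - 1) ^+ 2 * v ^+ 2.
  by rewrite /gap -/u -/s -/v; field; rewrite lt0r_neq0.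
have sK : `|s| <= r * K by rewrite normrM distrC ler_pM.
have vK : `|v| <= 2^-1 * K.
  rewrite normrM (ger0_norm pp0).
  apply: (@le_trans _ _ (4^-1 * (2 * K))); first by rewrite ler_pM.
  by rewrite mulrA ler_wpM2r//; lra.
(* Starting from [eK2] gives 1/8; squaring [vK] would only give 1/4, and the two sides together
   would then use up the whole slack in the equation solved by [rho]. *)
have v2 : v ^+ 2 <= 8^-1 * K ^+ 2.
  rewrite exprMn; apply: (@le_trans _ _ (16^-1 * (2 * K ^+ 2))); last lra.
  apply: ler_pM => //; rewrite ?sqr_ge0//.
  have -> : 16^-1 = 4^-1 ^+ 2 :> R by field.
  by rewrite ler_pXn2r ?nnegrE//; lra.
have s2 : s ^+ 2 <= r ^+ 2 * K ^+ 2.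
  rewrite -exprMn -[s ^+ 2]real_normK ?num_real//.
  by rewrite ler_pXn2r// ?nnegrE// mulr_ge0.
have sv : - (s * v) <= r * 2^-1 * K ^+ 2.
  apply: le_trans (ler_norm _) _; rewrite normrN normrM.
  by apply: le_trans (ler_pM _ _ sK vK) _ => //;
    rewrite le_eqVlt; apply/orP; left; apply/eqP; ring.
have wT : 0 <= w / (T - 1) by rewrite divr_ge0//; lra.
have wT2 : 0 <= w / (T - 1) ^+ 2 by rewrite divr_ge0// sqr_ge0.
have t1 : w * s ^+ 2 <= 4^-1 * (r ^+ 2 * K ^+ 2) by rewrite ler_pM ?sqr_ge0.
have t2 : 2 * (w / (T - 1)) * - (s * v) <= 2 * c * (r * 2^-1 * K ^+ 2).
  apply: (@le_trans _ _ (2 * (w / (T - 1)) * (r * 2^-1 * K ^+ 2))).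
    by apply: ler_wpM2l => //; rewrite mulr_ge0.
  by rewrite ler_wpM2r ?ler_pM2l// !mulr_ge0 ?sqr_ge0.
have t3 : w / (T - 1) ^+ 2 * v ^+ 2 <= g * (8^-1 * K ^+ 2).
  by rewrite ler_pM ?sqr_ge0.
have -> : (r ^+ 2 / 4 + r * c + g / 8) * K ^+ 2 =
  4^-1 * (r ^+ 2 * K ^+ 2) + 2 * c * (r * 2^-1 * K ^+ 2) + g * (8^-1 * K ^+ 2).
  by field.
move: t1 t2 t3; rewrite mulrN.
set A := w * _; set B := 2 * _ * _; set C := _ * v ^+ 2.
lra.
Qed.

(** Young's inequality: for r = |x - y| the defect is the square of x - y - eta y, divided by [eta].
    The loss on y is multiplicative, which suits a relative margin. *)
Lemma sqr_perturb x y r eta : 0 < eta -> `|x - y| <= r ->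
  x ^+ 2 <= (1 + eta) * y ^+ 2 + (1 + eta^-1) * r ^+ 2.
Proof.
move=> eta0 xyr.
apply: (@le_trans _ _ ((1 + eta) * y ^+ 2 + (1 + eta^-1) * (x - y) ^+ 2)).
  rewrite -subr_ge0.
  have -> : (1 + eta) * y ^+ 2 + (1 + eta^-1) * (x - y) ^+ 2 - x ^+ 2 =
    eta^-1 * (x - y - eta * y) ^+ 2 by field; rewrite lt0r_neq0.
  by rewrite mulr_ge0 ?invr_ge0 ?sqr_ge0// ltW.
rewrite lerD2l ler_wpM2l//; first by rewrite addr_ge0// invr_ge0 ltW.
rewrite -[leLHS]real_normK ?num_real// ler_pXn2r ?nnegrE//.
exact: le_trans xyr.
Qed.

Lemma sumsqr_perturb x y x' y' r eta w : 0 < eta -> 0 <= w <= 1 ->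
  `|x - x'| <= r -> `|y - y'| <= r ->
  w * (x ^+ 2 + y ^+ 2) <=
    (1 + eta) * (w * (x' ^+ 2 + y' ^+ 2)) + 2 * (1 + eta^-1) * r ^+ 2.
Proof.
move=> eta0 /andP[w0 w1] xr yr.
have := sqr_perturb eta0 xr; have := sqr_perturb eta0 yr.
set c := 1 + eta^-1.
have c0 : 0 <= c * r ^+ 2.
  by rewrite mulr_ge0 ?sqr_ge0// addr_ge0// invr_ge0 ltW.
move=> hy hx.
apply: (@le_trans _ _ (w * ((1 + eta) * x' ^+ 2 + c * r ^+ 2 +
  ((1 + eta) * y' ^+ 2 + c * r ^+ 2)))).
  by rewrite ler_wpM2l// lerD.
have -> : w * ((1 + eta) * x' ^+ 2 + c * r ^+ 2 +
  ((1 + eta) * y' ^+ 2 + c * r ^+ 2)) =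
  (1 + eta) * (w * (x' ^+ 2 + y' ^+ 2)) + w * (2 * (c * r ^+ 2)) by ring.
rewrite lerD2l -mulrA.
by rewrite ler_piMl// mulr_ge0.
Qed.

(** Each side loses a factor 1 + eta and an additive term of order r^2. The relative margin 1 -
    kappa pays for the factors and the lower bound [W0] for the additive terms, so one radius serves
    all values of the other variables. *)
Lemma sumsqr_gap_stable (kappa W0 : R) : kappa < 1 -> 0 < W0 ->
  exists2 r : R, 0 < r & forall x y x' y' w u v u' v' w0 : R,
    0 <= w <= 1 -> 0 <= w0 <= 1 ->
    `|x - x'| <= r -> `|y - y'| <= r -> `|u - u'| <= r -> `|v - v'| <= r ->
    W0 <= w0 * (u' ^+ 2 + v' ^+ 2) ->
    w * (x' ^+ 2 + y' ^+ 2) <= kappa * (w0 * (u' ^+ 2 + v' ^+ 2)) ->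
    w * (x ^+ 2 + y ^+ 2) < w0 * (u ^+ 2 + v ^+ 2).
Proof.
move=> k1 W00.
(* Raising a negative [kappa] to 0 keeps [eta] at most 1/4. *)
pose k := Num.max kappa 0.
have k0 : 0 <= k by rewrite le_max lexx orbT.
have {}k1 : k < 1 by rewrite gt_max k1 ltr01.
pose eta := (1 - k) / 4.
have eta0 : 0 < eta by rewrite /eta; lra.
have kE : k = 1 - 4 * eta by rewrite /eta; field.
pose c := 2 * (1 + eta^-1).
have c0 : 0 < c by rewrite mulr_gt0// addr_gt0// invr_gt0.
(* [r2] solves 3 c r2 = 2 eta W0. Capping the radius at 1 yields [r ^+ 2 <= r2] without a square
   root. *)
pose r2 := 2 * eta * W0 / (3 * c).
pose r := Num.min r2 1.
have r20 : 0 < r2.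
  apply: divr_gt0; last exact: mulr_gt0.
  by apply: mulr_gt0 => //; apply: mulr_gt0.
exists r; first by rewrite lt_min r20 ltr01.
move=> x y x' y' w u v u' v' w0 w01 w001 xr yr ur vr W0K wK.
have r_ge0 : 0 <= r by rewrite le_min (ltW r20) ler01.
have cr : 3 * (c * r ^+ 2) <= 2 * eta * W0.
  have : r ^+ 2 <= r2.
    rewrite expr2; apply: (@le_trans _ _ (r2 * 1)); last by rewrite mulr1.
    by apply: ler_pM => //; rewrite ge_min lexx ?orbT.
  move=> /(ler_wpM2l (ltW c0)).
  have -> : c * r2 = 2 * eta * W0 / 3 by rewrite /r2; field; rewrite lt0r_neq0.
  lra.
have h1 := sumsqr_perturb eta0 w01 xr yr.
(* At the reference point the perturbation is used backwards, bounding the primed value by the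
   unprimed one. *)
rewrite distrC in ur; rewrite distrC in vr.
have h2 := sumsqr_perturb eta0 w001 ur vr.
have {}wK : w * (x' ^+ 2 + y' ^+ 2) <= k * (w0 * (u' ^+ 2 + v' ^+ 2)).
  apply: (le_trans wK); rewrite ler_wpM2r//; last by rewrite le_max lexx.
  by apply: le_trans W0K; exact: ltW.
move: h1 h2 wK W0K; rewrite -/c.
set X := w * (x ^+ 2 + _); set X' := w * _; set U := w0 * (u ^+ 2 + _).
set U' := w0 * _; set C := c * _ in cr *.
move=> h1 h2 wK W0K.
have eta4 : eta <= 4^-1 by rewrite /eta; lra.
have C0 : 0 <= C by rewrite mulr_ge0 ?sqr_ge0// ltW.
have U'0 : 0 < U' by apply: lt_le_trans W0K.
rewrite -(ltr_pM2l (_ : 0 < 1 + eta)); last by lra.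
apply: (@lt_le_trans _ _ (U' - C)); last by lra.
apply: (@le_lt_trans _ _ ((1 + eta) * ((1 + eta) * (k * U') + C))).
  rewrite ler_pM2l; last lra.
  by apply: (le_trans h1); rewrite lerD2r ler_pM2l//; lra.
have -> : (1 + eta) * ((1 + eta) * (k * U') + C) =
  (1 - 2 * eta - 7 * eta ^+ 2 - 4 * eta ^+ 3) * U' + (1 + eta) * C.
  by rewrite kE; ring.
have e2U : 0 < (7 * eta ^+ 2 + 4 * eta ^+ 3) * U'.
  by rewrite mulr_gt0// addr_gt0// mulr_gt0// exprn_gt0.
have eW : eta * W0 <= eta * U' by rewrite ler_pM2l.
have eC : eta * C <= 4^-1 * C by rewrite ler_wpM2r.
have -> : (1 - 2 * eta - 7 * eta ^+ 2 - 4 * eta ^+ 3) * U' + (1 + eta) * C =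
  U' - 2 * (eta * U') - (7 * eta ^+ 2 + 4 * eta ^+ 3) * U' + C + eta * C by ring.
set Q := (7 * _ + _) * _ in e2U *.
lra.
Qed.

End Gap.

(** * Pairwise averages *)

Section Scan.
Context {R : realType} {n : nat}.
Implicit Types (f g : 'I_n -> 'I_n -> R) (t : nat) (c : 'I_n -> bool).

(** [T11], [T22], [T12] and [Dn] with an arbitrary matrix in place of the dissimilarities: observed,
    permuted and population matrices can then be compared, and the matrix of dissimilarities gives
    back the originals by conversion. *)
Definition within_fst f t : R :=
  'C(t, 2)%:R^-1 * \sum_(i < n) \sum_(j < n | (i < j < t)%N) f i j.

Definition within_snd f t : R :=
  'C(n - t, 2)%:R^-1 * \sum_(i < n) \sum_(j < n | (t <= i < j)%N) f i j.

Definition between f t : R :=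
  (t * (n - t))%:R^-1 * \sum_(i < n | (i < t)%N) \sum_(j < n | (t <= j)%N) f i j.

Definition scanD f t : R :=
  (between f t - within_fst f t) ^+ 2 + (between f t - within_snd f t) ^+ 2.

(** By symmetry the pairs with i < j and those with j < i have the same sum, and with the diagonal
    they fill the square. Sums over a square are what can be evaluated on a block matrix. *)
Lemma sum_ltn_pairs (P : pred 'I_n) f : (forall i j, f i j = f j i) ->
  2 * \sum_(i < n) \sum_(j < n | [&& (i < j)%N, P i & P j]) f i j =
  \sum_(i < n | P i) \sum_(j < n | P j) f i j - \sum_(i < n | P i) f i i.
Proof.
move=> fC; apply/eqP; rewrite eq_sym subr_eq; apply/eqP.
have e1 : \sum_(i < n) \sum_(j < n | [&& (i < j)%N, P i & P j]) f i j =
    \sum_(i < n | P i) \sum_(j < n | P j && (i < j)%N) f i j.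
  rewrite [RHS]big_mkcond; apply: eq_bigr => i _.
  case: (P i) => /=; first by apply: eq_bigl => j; rewrite andbC.
  by rewrite big1// => j; rewrite andbF.
have e2 : \sum_(i < n) \sum_(j < n | [&& (i < j)%N, P i & P j]) f i j =
    \sum_(i < n | P i) \sum_(j < n | P j && (j < i)%N) f i j.
  rewrite e1 (exchange_big_dep P)//=; last by move=> i j _ /andP[].
  apply: eq_bigr => i Pi; apply: eq_big => [j|j _]; last exact: fC.
  by rewrite Pi.
rewrite mulr_natl mulr2n {1}e1 e2 -!big_split/=; apply: eq_bigr => i Pi.
rewrite (bigD1 i)//= addrC; congr (_ + _).
rewrite (bigID (fun j : 'I_n => (i < j)%N))/=; congr (_ + _); apply: eq_bigl => j.
  by rewrite -val_eqE/=; case: (P j) => //=; lia.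
by rewrite -val_eqE/=; case: (P j) => //=; lia.
Qed.

Lemma binom2E t : t%:R * (t%:R - 1) = 2 * 'C(t, 2)%:R :> R.
Proof.
case: t => [|t]; first by rewrite mul0r bin0n mulr0.
have -> : t.+1%:R - 1 = t%:R :> R by rewrite -natr1 addrK.
by rewrite -!natrM -mul_bin_diag bin1.
Qed.

Lemma within_fstE f t : (forall i j, f i j = f j i) -> (2 <= t)%N ->
  within_fst f t = (t%:R * (t%:R - 1))^-1 *
    (\sum_(i < n | (i < t)%N) \sum_(j < n | (j < t)%N) f i j
     - \sum_(i < n | (i < t)%N) f i i).
Proof.
move=> fC t2; rewrite -(sum_ltn_pairs (fun i => (i < t)%N))// /within_fst.
rewrite binom2E.
rewrite invfM mulrACA mulVf// mul1r; congr (_ * _).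
by apply: eq_bigr => i _; apply: eq_bigl => j; apply/idP/idP; lia.
Qed.

Lemma within_sndE f t : (forall i j, f i j = f j i) -> (2 <= n - t)%N ->
  within_snd f t = ((n - t)%:R * ((n - t)%:R - 1))^-1 *
    (\sum_(i < n | (t <= i)%N) \sum_(j < n | (t <= j)%N) f i j
     - \sum_(i < n | (t <= i)%N) f i i).
Proof.
move=> fC t2; rewrite -(sum_ltn_pairs (fun i : 'I_n => (t <= i)%N))// /within_snd.
rewrite binom2E invfM mulrACA mulVf// mul1r; congr (_ * _).
by apply: eq_bigr => i _; apply: eq_bigl => j; apply/idP/idP; lia.
Qed.

Lemma card_ltn t : (t <= n)%N -> \sum_(i < n | (i < t)%N) 1 = t%:R :> R.
Proof.
by move=> tn; rewrite -(big_ord_widen _ (fun=> 1) tn) sumr_const card_ord.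
Qed.

Lemma card_geq t : (t <= n)%N -> \sum_(i < n | (t <= i)%N) 1 = (n - t)%:R :> R.
Proof.
move=> tn; rewrite natrB// -(card_ltn tn).
apply/eqP; rewrite eq_sym subr_eq addrC; apply/eqP.
have -> : n%:R = \sum_(i < n) 1 :> R by rewrite sumr_const card_ord.
rewrite (bigID (fun i : 'I_n => (i < t)%N))/=; congr (_ + _).
by apply: eq_bigl => i; rewrite -leqNgt.
Qed.

Lemma between_perturb f g t e : (0 < t < n)%N ->
  (forall i j, i != j -> `|f i j - g i j| <= e) ->
  `|between f t - between g t| <= e.
Proof.
move=> /andP[t0 tn] fg; rewrite /between -mulrBr normrM.
have tn0 : (0 < t * (n - t))%N by rewrite muln_gt0 t0 subn_gt0.
rewrite ger0_norm ?invr_ge0// mulrC ler_pdivrMr ?ltr0n//.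
rewrite -sumrB; apply: (le_trans (ler_norm_sum _ _ _)).
apply: (@le_trans _ _ (\sum_(i < n | (i < t)%N) \sum_(j < n | (t <= j)%N) e)).
  apply: ler_sum => i it; rewrite -sumrB; apply: (le_trans (ler_norm_sum _ _ _)).
  apply: ler_sum => j jt; apply: fg; rewrite -val_eqE/=; lia.
have -> : \sum_(j < n | (t <= j)%N) e = (n - t)%:R * e.
  by rewrite -card_geq ?(ltnW tn)// mulr_suml; apply: eq_bigr => j _; rewrite mul1r.
rewrite [leRHS]mulrC natrM -mulrA -[in leRHS]card_ltn ?(ltnW tn)// mulr_suml.
by apply: ler_sum => i _; rewrite mul1r.
Qed.

(** Closeness is asked off the diagonal only: a dissimilarity of a point with itself is 0 and does
    not approach [f11] or [f22]. *)
Lemma pairs_perturb (Q : rel 'I_n) f g N e : (2 <= N)%N ->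
  (forall i j, Q i j -> i != j) ->
  \sum_(i < n) \sum_(j < n | Q i j) 1 = 'C(N, 2)%:R :> R ->
  (forall i j, i != j -> `|f i j - g i j| <= e) ->
  `|'C(N, 2)%:R^-1 * \sum_(i < n) \sum_(j < n | Q i j) f i j -
    'C(N, 2)%:R^-1 * \sum_(i < n) \sum_(j < n | Q i j) g i j| <= e.
Proof.
move=> N2 Qij cQ fg; rewrite -mulrBr normrM.
have C0 : (0 < 'C(N, 2))%N by rewrite bin_gt0.
rewrite ger0_norm ?invr_ge0// mulrC ler_pdivrMr ?ltr0n//.
rewrite -sumrB; apply: (le_trans (ler_norm_sum _ _ _)).
rewrite -cQ mulr_sumr; apply: ler_sum => i _; rewrite -sumrB.
apply: (le_trans (ler_norm_sum _ _ _)); rewrite mulr_sumr; apply: ler_sum => j /Qij ij.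
by rewrite mulr1; exact: fg.
Qed.

Lemma within_fst_perturb f g t e : (2 <= t <= n)%N ->
  (forall i j, i != j -> `|f i j - g i j| <= e) ->
  `|within_fst f t - within_fst g t| <= e.
Proof.
move=> /andP[t2 tn] fg.
apply: (@pairs_perturb (fun i j => i < j < t)%N) => //.
  by move=> i j; rewrite -val_eqE/=; lia.
have C0 : 'C(t, 2)%:R != 0 :> R by rewrite pnatr_eq0 -lt0n bin_gt0.
(* The number of pairs is read off from [within_fstE] applied to the constant matrix 1. *)
have /(congr1 ( *%R 'C(t, 2)%:R)) := within_fstE (f := fun _ _ => 1) (fun _ _ => erefl) t2.
rewrite /within_fst mulVKf// => ->; rewrite binom2E.
have -> : \sum_(i < n | (i < t)%N) \sum_(j < n | (j < t)%N) 1 = t%:R * t%:R :> R.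
  rewrite -{1}card_ltn// mulr_suml; apply: eq_bigr => i _.
  by rewrite mul1r card_ltn.
rewrite card_ltn// -[X in _ - X]mulr1 -mulrBr binom2E.
by rewrite mulVf ?mulr1// mulf_neq0// pnatr_eq0.
Qed.

Lemma within_snd_perturb f g t e : (t <= n - 2)%N -> (2 <= n)%N ->
  (forall i j, i != j -> `|f i j - g i j| <= e) ->
  `|within_snd f t - within_snd g t| <= e.
Proof.
move=> t2 n2 fg; have tn : (t <= n)%N by lia.
have nt2 : (2 <= n - t)%N by lia.
apply: (@pairs_perturb (fun i j => t <= i < j)%N) => //.
  by move=> i j; rewrite -val_eqE/=; lia.
have C0 : 'C(n - t, 2)%:R != 0 :> R by rewrite pnatr_eq0 -lt0n bin_gt0.
have /(congr1 ( *%R 'C(n - t, 2)%:R)) := within_sndE (f := fun _ _ => 1) (fun _ _ => erefl) nt2.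
rewrite /within_snd mulVKf// => ->; rewrite binom2E.
have -> : \sum_(i < n | (t <= i)%N) \sum_(j < n | (t <= j)%N) 1 = (n - t)%:R * (n - t)%:R :> R.
  rewrite -{1}card_geq// mulr_suml; apply: eq_bigr => i _.
  by rewrite mul1r card_geq.
rewrite card_geq// -[X in _ - X]mulr1 -mulrBr binom2E.
by rewrite mulVf ?mulr1// mulf_neq0// pnatr_eq0.
Qed.
End Scan.

(** * Separation of the population scan *)

Section Weight.
Context {R : realType}.
Implicit Types n m t : nat.

Lemma weight_sym n t : (t <= n)%N -> weight n (n - t) = weight n t :> R.
Proof. by move=> tn; rewrite /weight subKn// mulnC. Qed.

Lemma weight_ge0 n t : 0 <= weight n t :> R.
Proof. by rewrite /weight divr_ge0// sqr_ge0. Qed.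

Lemma weight_gt0 n t : (0 < t < n)%N -> 0 < weight n t :> R.
Proof.
move=> /andP[t0 tn]; have n0 := ltn_trans t0 tn.
by rewrite /weight divr_gt0 ?exprn_gt0 ?ltr0n// muln_gt0 t0 subn_gt0.
Qed.

Lemma weight_le4 n t : (0 < n)%N -> (t <= n)%N -> weight n t <= 4^-1 :> R.
Proof.
move=> n0 tn; rewrite /weight ler_pdivrMr ?exprn_gt0 ?ltr0n// natrM natrB//.
have := sqr_ge0 (n%:R - 2 * t%:R : R).
have -> : (n%:R - 2 * t%:R) ^+ 2 = n%:R ^+ 2 - 4 * (t%:R * (n%:R - t%:R)) :> R by ring.
lra.
Qed.

(** Makes the finite sample correction uniform over the range of the scan. After
    cross-multiplication the difference is (t-m)(n-t) + m(t-m)(t-1), a sum of nonnegative terms. *)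
Lemma weight_div_le n m t : (2 <= m <= t)%N -> (t <= n)%N ->
  weight n t / (t%:R - 1) <= weight n m / (m%:R - 1) :> R.
Proof.
move=> /andP[m2 mt] tn; have n0 : (0 < n)%N by lia.
have m1 : 0 < m%:R - 1 :> R by rewrite subr_gt0 ltr1n.
have mtR : m%:R <= t%:R :> R by rewrite ler_nat.
have tnR : t%:R <= n%:R :> R by rewrite ler_nat.
rewrite ler_pdivrMr; last lra.
rewrite mulrAC ler_pdivlMr// /weight -!mulrA ![_^-1 * _]mulrC !mulrA.
rewrite ler_wpM2r ?invr_ge0 ?sqr_ge0// !natrM !natrB//; last by lia.
rewrite -subr_ge0.
have -> : m%:R * (n%:R - m%:R) * (t%:R - 1) - t%:R * (n%:R - t%:R) * (m%:R - 1) =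
  (t%:R - m%:R) * (n%:R - t%:R) + m%:R * (t%:R - m%:R) * (t%:R - 1) :> R by ring.
by rewrite addr_ge0// mulr_ge0 ?mulr_ge0//; lra.
Qed.

Lemma weight_div_sqr_le n m t : (2 <= m <= t)%N -> (t <= n)%N ->
  weight n t / (t%:R - 1) ^+ 2 <= weight n m / (m%:R - 1) ^+ 2 :> R.
Proof.
move=> mt tn; have le1 := weight_div_le mt tn; move: mt => /andP[m2 mt].
have m1 : 0 < m%:R - 1 :> R by rewrite subr_gt0 ltr1n.
have mtR : m%:R <= t%:R :> R by rewrite ler_nat.
rewrite !expr2 !invfM !mulrA; apply: ler_pM => //.
- by rewrite divr_ge0 ?weight_ge0//; lra.
- by rewrite invr_ge0; lra.
- by rewrite lef_pV2 ?posrE//; lra.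
Qed.

End Weight.

Section Popmx.
Context {R : realType} {n : nat} (f11 f12 f22 : R).
Implicit Types (c : 'I_n -> bool) (t : nat).

(** [c] marks the positions that hold an observation from F_1. The diagonal is filled like the rest
    of its block, so that block sums factor through counts. *)
Definition popmx c (i j : 'I_n) : R :=
  if c i then (if c j then f11 else f12) else if c j then f12 else f22.

Lemma popmxC c i j : popmx c i j = popmx c j i.
Proof. by rewrite /popmx; case: (c i); case: (c j). Qed.

Lemma sum_if_affine (P : pred 'I_n) c (x y : R) :
  \sum_(i < n | P i) (if c i then x else y) =
  (\sum_(i < n | P i) (c i)%:R) * x +
  (\sum_(i < n | P i) 1 - \sum_(i < n | P i) (c i)%:R) * y.
Proof.
rewrite -sumrB !mulr_suml -big_split/=; apply: eq_bigr => i _.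
by case: (c i); rewrite ?subrr ?subr0 ?mul1r ?mul0r ?addr0 ?add0r.
Qed.

Lemma sum_popmx (P Q : pred 'I_n) c :
  let X := \sum_(i < n | P i) (c i)%:R in let T := \sum_(i < n | P i) 1 in
  let Y := \sum_(i < n | Q i) (c i)%:R in let N := \sum_(i < n | Q i) 1 in
  \sum_(i < n | P i) \sum_(j < n | Q j) popmx c i j =
  X * (Y * f11 + (N - Y) * f12) + (T - X) * (Y * f12 + (N - Y) * f22).
Proof.
move=> X T Y N; rewrite -sum_if_affine; apply: eq_bigr => i _; rewrite /popmx.
by case: (c i); rewrite sum_if_affine.
Qed.

Lemma sum_popmx_diag (P : pred 'I_n) c :
  let X := \sum_(i < n | P i) (c i)%:R in let T := \sum_(i < n | P i) 1 in
  \sum_(i < n | P i) popmx c i i = X * f11 + (T - X) * f22.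
Proof.
move=> X T; rewrite -sum_if_affine; apply: eq_bigr => i _; rewrite /popmx.
by case: (c i).
Qed.

(** Block sums depend on [c] only through the number of marked positions on each side of [t]. The
    scan is therefore a rational function of the two fractions, and the subtracted diagonal produces
    the correction term of [gap]. *)
Lemma scanD_popmx c t : (2 <= t)%N -> (2 <= n - t)%N ->
  let p := (\sum_(i < n | (i < t)%N) (c i)%:R) / t%:R in
  let q := (\sum_(i < n | (t <= i)%N) (c i)%:R) / (n - t)%:R in
  let a := f12 - f11 in let b := f12 - f22 in
  scanD (popmx c) t = gap a b p q t%:R ^+ 2 + gap a b q p (n - t)%:R ^+ 2.
Proof.
move=> t2 nt2 p q a b.
have tn : (t <= n)%N by lia.
have T0 : t%:R != 0 :> R by rewrite pnatr_eq0; lia.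
have N0 : (n - t)%:R != 0 :> R by rewrite pnatr_eq0; lia.
have T1 : t%:R - 1 != 0 :> R by rewrite subr_eq0 (eqr_nat _ t 1); lia.
have N1 : (n - t)%:R - 1 != 0 :> R by rewrite subr_eq0 (eqr_nat _ (n - t) 1); lia.
rewrite /scanD within_fstE ?within_sndE//; try exact: popmxC.
rewrite /between !sum_popmx !sum_popmx_diag !card_ltn// !card_geq//.
rewrite /p /q /a /b /gap natrM.
set X := \sum_(i < n | _) _; set Y := \sum_(i < n | _) _.
set T := t%:R in T0 T1 *; set N := (n - t)%:R in N0 N1 *.
congr (_ ^+ 2 + _ ^+ 2).
  by field; rewrite T0 T1 N0.
by field; rewrite T0 N1 N0.
Qed.

End Popmx.

Lemma in_range_bounds (n m t : nat) : (2 <= m)%N -> in_range n m t ->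
  [/\ (2 <= t)%N, (2 <= n - t)%N & (t <= n)%N].
Proof. by rewrite /in_range => m2 /andP[? ?]; split; lia. Qed.

Section Separation.
Context {R : realType} (n m tau : nat).
Hypotheses (m2 : (2 <= m)%N) (tauR : in_range n m tau).
Implicit Types (a b : R) (p : 'S_n) (t : nat).

Lemma sum_color p : \sum_(i < n) (p i < tau)%N%:R = tau%:R :> R.
Proof.
have [? ? taun] := in_range_bounds m2 tauR.
rewrite -[RHS](card_ltn taun) [RHS]big_mkcond.
rewrite [RHS](reindex_inj (@perm_inj _ p))/=.
by apply: eq_bigr => i _; case: ifP.
Qed.

Lemma sum_color_snd p t : \sum_(i < n | (t <= i)%N) (p i < tau)%N%:R =
  tau%:R - \sum_(i < n | (i < t)%N) (p i < tau)%N%:R :> R.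
Proof.
rewrite -(sum_color p) [X in X - _](bigID (fun i : 'I_n => (i < t)%N))/= [RHS]addrC addKr.
by apply: eq_bigl => i; rewrite -leqNgt.
Qed.

Lemma sum_color_fst p t : \sum_(i < n | (i < t)%N) (p i < tau)%N%:R =
  (kperm tau p t)%:R :> R.
Proof.
rewrite /kperm -sum1_card natr_sum [LHS]big_mkcond [RHS]big_mkcond/=.
by apply: eq_bigr => i _; rewrite inE; case: (i < t)%N; case: (p i < tau)%N.
Qed.

Variables f11 f12 f22 : R.
Let a := f12 - f11.
Let b := f12 - f22.
(** Population matrix of the sample permuted by [p]; the identity gives the original sample. *)
Let F p := popmx f11 f12 f22 (fun i : 'I_n => (p i < tau)%N).

(** At the true split p = 1 and q = 0, so both corrections p(1-p) and q(1-q) vanish. *)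
Lemma scanD_pop_at : scanD (F 1%g) tau = a ^+ 2 + b ^+ 2.
Proof.
have [t2 nt2 tn] := in_range_bounds m2 tauR.
rewrite scanD_popmx// sum_color_snd.
have -> : \sum_(i < n | (i < tau)%N) ((1%g : 'S_n) i < tau)%N%:R = tau%:R :> R.
  by rewrite -(card_ltn tn); apply: eq_bigr => i it; rewrite perm1 it.
rewrite subrr mul0r divff ?pnatr_eq0; last by lia.
by rewrite /gap -/a -/b; congr (_ ^+ 2 + _ ^+ 2);
  rewrite ?subrr !(mulr0, mul0r, subr0, sub0r, mul1r, mulN1r, opprK).
Qed.

(** One side of a wrong split is pure, and [gap_pure] trades the size of the mixed side for the size
    it has at [tau]. The size of the pure side is left, and it is strictly smaller than at [tau]. *)
Lemma scanD_pop_off t : in_range n m t -> t <> tau ->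
  weight n t * scanD (F 1%g) t <=
  (1 - n%:R^-1) * (weight n tau * scanD (F 1%g) tau).
Proof.
move=> tR /eqP ttau; rewrite scanD_pop_at.
have [t2 nt2 tn] := in_range_bounds m2 tR.
have [tau2 ntau2 taun] := in_range_bounds m2 tauR.
have n0 : 0 < n%:R :> R by rewrite ltr0n; lia.
have K0 : 0 <= a ^+ 2 + b ^+ 2 by rewrite addr_ge0 ?sqr_ge0.
(* The factor 1 - 1/n comes from integrality: u <= v - 1, and v / n <= 1. *)
have shrink (u v : nat) : (u < v <= n)%N -> u%:R <= (1 - n%:R^-1) * v%:R :> R.
  move=> /andP[uv vn]; apply: (@le_trans _ _ (v%:R - 1)).
    by rewrite lerBrDr natr1 ler_nat.
  by rewrite mulrBl mul1r lerD2l lerN2 ler_pdivrMl// mulr1 ler_nat.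
suff main : (t * (n - t))%:R * scanD (F 1%g) t <=
    (1 - n%:R^-1) * ((tau * (n - tau))%:R * (a ^+ 2 + b ^+ 2)).
  rewrite /weight ![_ / _ * _]mulrAC [leRHS]mulrA ler_wpM2r ?invr_ge0 ?sqr_ge0//.
rewrite scanD_popmx// -/a -/b sum_color_snd !natrM.
have [ltt|] := ltnP t tau.
  have -> : \sum_(i < n | (i < t)%N) ((1%g : 'S_n) i < tau)%N%:R = t%:R :> R.
    by rewrite -(card_ltn tn); apply: eq_bigr => i it; rewrite perm1 (ltn_trans it ltt).
  rewrite divff ?pnatr_eq0; last by lia.
  have -> : (n - t)%:R = (n - tau)%:R + (tau%:R - t%:R) :> R.
    by rewrite -natrB 1?ltnW// -natrD; congr _%:R; lia.
  set M := (n - tau)%:R; set s := tau%:R - t%:R.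
  have M2 : 2 <= M by rewrite ler_nat.
  have s1 : 1 <= s by rewrite /s lerBrDr addrC natr1 ler_nat.
  rewrite -mulrA; apply: (le_trans (ler_wpM2l (ler0n _ _) (gap_pure _ _ _ M2 s1))).
  rewrite [leRHS]mulrA [X in _ <= X * _]mulrA -[X in _ <= X]mulrA.
  by rewrite ler_wpM2r ?shrink ?ltt// mulr_ge0//; lra.
rewrite leq_eqVlt eq_sym (negbTE ttau)/= => ltt.
have Y0 : tau%:R - \sum_(i < n | (i < t)%N) ((1%g : 'S_n) i < tau)%N%:R = 0 :> R.
  rewrite -(sum_color_snd 1%g t) big1// => i ti; rewrite perm1.
  by have /negbTE -> : ~~ (i < tau)%N by rewrite -leqNgt; exact: leq_trans (ltnW ltt) ti.
rewrite Y0; move/eqP: Y0; rewrite subr_eq0 => /eqP <-.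
(* For t > tau the second sample is pure F_2; once the populations are exchanged, [gap_pure] applies
   with M = tau and s = t - tau. *)
rewrite mul0r (gap_swap a b) (gap_swap a b 0) subr0.
rewrite (mulrC t%:R) -[leLHS]mulrA.
set M := tau%:R; pose s := t%:R - M.
have -> : 1 - M / t%:R = s / t%:R.
  by rewrite mulrBl divff// pnatr_eq0; lia.
have -> : t%:R = M + s by rewrite addrC subrK.
have M2 : 2 <= M by rewrite ler_nat.
have s1 : 1 <= s by rewrite /s lerBrDr addrC natr1 ler_nat.
rewrite [X in _ * (_ * X)]addrC.
apply: (le_trans (ler_wpM2l (ler0n _ _) (gap_pure _ _ _ M2 s1))).
rewrite (mulrC M (n - tau)%:R) -[in leRHS]mulrA [leRHS]mulrA (addrC (b ^+ 2)).
rewrite ler_wpM2r ?shrink//; last by lia.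
by rewrite mulr_ge0//; lra.
Qed.

Let c : R := weight n m / (m%:R - 1).
Let g : R := weight n m / (m%:R - 1) ^+ 2.

(** [rho] is the larger root of this quadratic. Since [c] is positive, a nonnegative [rho] forces a
    positive square root, which excludes the value 0 that [Num.sqrt] takes at a negative
    discriminant. *)
Lemma rho_quadratic : 0 <= rho n m tau :> R ->
  rho n m tau ^+ 2 / 2 + 2 * (rho n m tau * c) = weight n tau - g / 2.
Proof.
have [tau2 ntau2 taun] := in_range_bounds m2 tauR.
have m1 : 0 < m%:R - 1 :> R by rewrite subr_gt0 ltr1n.
have c0 : 0 < c by rewrite divr_gt0// weight_gt0//; move: tauR; rewrite /in_range; lia.
rewrite /rho -/c.
have -> : weight n m / (2 * (m%:R - 1) ^+ 2) = g / 2 :> R.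
  by rewrite /g invfM mulrA mulrAC.
set D := 4 * c ^+ 2 + _; set S := Num.sqrt D => rho0.
have S0 : 0 < S by lra.
have -> : (- 2 * c + S) ^+ 2 / 2 + 2 * ((- 2 * c + S) * c) = S ^+ 2 / 2 - 2 * c ^+ 2.
  by field.
rewrite sqr_sqrtr; first by rewrite /D; field.
by rewrite ltW// -sqrtr_gt0.
Qed.

Lemma balanced_le p t : p \notin Bset n m tau (rho n m tau : R) ->
  in_range n m t -> `|pperm tau p t - qperm tau p t| <= rho n m tau :> R.
Proof.
rewrite inE -leNgt => le_rho /andP[mt tnm]; apply: le_trans le_rho.
apply: (@le_bigmax_seq _ _ _ _ 0 t xpredT (fun t => `|pperm tau p t - qperm tau p t|)) => //.
by rewrite mem_index_iota mt ltnS.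
Qed.

(** Applying [sqr_gap_le] with r = rho to both sides of the split gives the total rho^2/2 + 2 rho c
    + g/4, which is w(tau) - g/4 by [rho_quadratic]. The remaining g/4 is the relative margin. *)
Lemma scanD_pop_balanced p t : p \notin Bset n m tau (rho n m tau : R) ->
  in_range n m t ->
  weight n t * scanD (F p) t <=
  (1 - g / (4 * weight n tau)) * (weight n tau * scanD (F 1%g) tau).
Proof.
move=> pB tR; have pq := balanced_le pB tR.
rewrite scanD_pop_at.
have [t2 nt2 tn] := in_range_bounds m2 tR.
have [tau2 ntau2 taun] := in_range_bounds m2 tauR.
have n0 : (0 < n)%N by lia.
have /andP[mt tnm] := tR.
have mt2 : (2 <= m <= t)%N by rewrite m2.
have mnt : (2 <= m <= n - t)%N by move: m2 mt tnm t2 nt2 tn; clear; lia.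
have w0 : 0 < weight n tau :> R by apply: weight_gt0; lia.
(* A single balanced permutation already makes [rho] nonnegative, as [rho_quadratic] requires. *)
have rho0 : 0 <= rho n m tau :> R by apply: le_trans pq.
have K20 : 0 <= a ^+ 2 + b ^+ 2 by rewrite addr_ge0 ?sqr_ge0.
pose K := Num.sqrt (a ^+ 2 + b ^+ 2).
have KE : K ^+ 2 = a ^+ 2 + b ^+ 2 by rewrite sqr_sqrtr.
have kt : (kperm tau p t <= t)%N.
  rewrite -(ler_nat R) -sum_color_fst -(card_ltn tn).
  by apply: ler_sum => i _; case: (p i < tau)%N.
have ktau0 : 0 <= tau%:R - (kperm tau p t)%:R :> R.
  by rewrite -sum_color_fst -sum_color_snd sumr_ge0.
have ktau1 : tau%:R - (kperm tau p t)%:R <= (n - t)%:R :> R.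
  rewrite -sum_color_fst -sum_color_snd -(card_geq tn).
  by apply: ler_sum => i _; case: (p i < tau)%N.
have p01 : 0 <= (pperm tau p t : R) <= 1.
  by rewrite divr_ge0//= ler_pdivrMr ?mul1r ?ler_nat// ltr0n ltnW.
have q01 : 0 <= (qperm tau p t : R) <= 1.
  by rewrite divr_ge0//= ler_pdivrMr ?mul1r// ltr0n ltnW.
have w4 : 0 <= (weight n t : R) <= 4^-1 by rewrite weight_ge0 weight_le4.
rewrite scanD_popmx// -/a -/b sum_color_snd sum_color_fst -/(pperm tau p t) -/(qperm tau p t).
have T1 : 1 < t%:R :> R by rewrite ltr1n.
have N1 : 1 < (n - t)%:R :> R by rewrite ltr1n.
have gE : a ^+ 2 + b ^+ 2 <= K ^+ 2 by rewrite KE.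
have b1 := sqr_gap_le p01 T1 w4 pq gE (sqrtr_ge0 _)
  (weight_div_le mt2 tn) (weight_div_sqr_le mt2 tn).
rewrite distrC in pq; rewrite -(weight_sym tn) in w4.
have b2 := sqr_gap_le q01 N1 w4 pq gE (sqrtr_ge0 _)
  (weight_div_le mnt (leq_subr _ _)) (weight_div_sqr_le mnt (leq_subr _ _)).
rewrite weight_sym// in b2.
have -> : (1 - g / (4 * weight n tau)) * (weight n tau * (a ^+ 2 + b ^+ 2)) =
  (weight n tau - g / 4) * K ^+ 2.
  by rewrite KE; field; rewrite gt_eqF.
have g0 : 0 <= g * K ^+ 2.
  by rewrite mulr_ge0 ?sqr_ge0// divr_ge0 ?sqr_ge0 ?weight_ge0.
have := rho_quadratic rho0; move: b1 b2; rewrite mulrDr -/c -/g -/K.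
set r := rho n m tau; set k := K ^+ 2 in g0 *.
set B1 := weight n t * _; set B2 := weight n t * _ => b1 b2 rq.
have -> : weight n tau = r ^+ 2 / 2 + 2 * (r * c) + g / 2 by rewrite rq subrK.
apply: (le_trans (lerD b1 b2)); rewrite -subr_ge0.
have -> : (r ^+ 2 / 2 + 2 * (r * c) + g / 2 - g / 4) * k -
  ((r ^+ 2 / 4 + r * c + g / 8) * k + (r ^+ 2 / 4 + r * c + g / 8) * k) = 0 by field.
by [].
Qed.

End Separation.

(** The deterministic core of both conclusions. The radius [e] is chosen before the population
    values, so it stays the same along the whole sequence of dimensions. *)
Lemma scanD_separation (R : realType) (n m tau : nat) (l : R) :
  (2 <= m)%N -> in_range n m tau -> 0 < l ->
  exists2 e : R, 0 < e & forall (f11 f12 f22 : R) (f : 'I_n -> 'I_n -> R),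
    l <= 2 * f12 - f11 - f22 ->
    (forall i j, i != j ->
       `|f i j - popmx f11 f12 f22 (fun k : 'I_n => (k < tau)%N) i j| <= e) ->
    (forall t, in_range n m t -> t <> tau ->
       weight n t * scanD f t < weight n tau * scanD f tau) /\
    (forall p : 'S_n, p \notin Bset n m tau (rho n m tau : R) ->
     forall t, in_range n m t ->
       weight n t * scanD (fun i j => f (p i) (p j)) t < weight n tau * scanD f tau).
Proof.
move=> m2 tauR l0; have [tau2 ntau2 taun] := in_range_bounds m2 tauR.
have /andP[mtau taum] := tauR.
have w0 : 0 < weight n tau :> R by apply: weight_gt0; lia.
have n0 : (0 < n)%N by lia.
have m1 : 0 < m%:R - 1 :> R by rewrite subr_gt0 ltr1n.
pose g : R := weight n m / (m%:R - 1) ^+ 2.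
have g0 : 0 < g by rewrite divr_gt0 ?exprn_gt0// weight_gt0//; lia.
pose kappa : R := Num.max (1 - n%:R^-1) (1 - g / (4 * weight n tau)).
have k1 : kappa < 1.
  rewrite gt_max !gtrBl invr_gt0 ltr0n n0/= divr_gt0// mulr_gt0//.
(* From a^2 + b^2 >= (a + b)^2 / 2, where a + b is the energy and is at least [l]. *)
pose W0 : R := weight n tau * (l ^+ 2 / 2).
have W00 : 0 < W0 by rewrite mulr_gt0// divr_gt0// exprn_gt0.
have [r r0 stable] := sumsqr_gap_stable k1 W00.
(* Each quantity squared in the scan is a difference of two averages, so entrywise errors count
   twice. *)
exists (r / 2); first by rewrite divr_gt0.
move=> f11 f12 f22 f le fe.
pose F (p : 'S_n) := popmx f11 f12 f22 (fun i => (p i < tau)%N).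
have w01 t : in_range n m t -> 0 <= (weight n t : R) <= 1.
  move=> /(in_range_bounds m2)[_ _ tn].
  by rewrite weight_ge0 (le_trans (weight_le4 n0 tn))//; lra.
have feF (p : 'S_n) i j : i != j -> `|f (p i) (p j) - F p i j| <= r / 2.
  by move=> ij; apply: fe; rewrite (inj_eq (@perm_inj _ _)).
have Fl : W0 <= weight n tau * scanD (F 1%g) tau.
  rewrite ler_pM2l// (scanD_pop_at m2 tauR) ler_pdivrMr//.
  rewrite mulrC; apply: le_trans (sqrD_le _ _).
  have -> : f12 - f11 + (f12 - f22) = 2 * f12 - f11 - f22 by ring.
  by rewrite ler_pXn2r ?nnegrE//; move: le l0; lra.
have dist (p : 'S_n) t : in_range n m t ->
    `|between (fun i j => f (p i) (p j)) t - within_fst (fun i j => f (p i) (p j)) t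
      - (between (F p) t - within_fst (F p) t)| <= r /\
    `|between (fun i j => f (p i) (p j)) t - within_snd (fun i j => f (p i) (p j)) t
      - (between (F p) t - within_snd (F p) t)| <= r.
  move=> /(in_range_bounds m2)[t2 nt2 tn].
  have tri (x y x' y' : R) : `|x - x'| <= r / 2 -> `|y - y'| <= r / 2 ->
      `|x - y - (x' - y')| <= r.
    move=> xx yy; have -> : x - y - (x' - y') = (x - x') - (y - y') by ring.
    by apply: (le_trans (ler_normB _ _)); rewrite (splitr r) lerD.
  have [t0n t2n tn2 n2] : [/\ (0 < t < n)%N, (2 <= t <= n)%N, (t <= n - 2)%N & (2 <= n)%N].
    by move: t2 nt2 tn; clear; split; lia.
  split; apply: tri.
  - exact: between_perturb (feF p).
  - exact: within_fst_perturb (feF p).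
  - exact: between_perturb (feF p).
  - exact: within_snd_perturb (feF p).
have f1 : f = fun i j => f ((1%g : 'S_n) i) ((1%g : 'S_n) j).
  by apply/funext => i; apply/funext => j; rewrite !perm1.
have [du dv] := dist 1%g _ tauR; rewrite -f1 in du dv.
have K0 : 0 <= weight n tau * scanD (F 1%g) tau.
  by apply: le_trans Fl; exact: ltW.
split=> [t tR ttau|p pB t tR].
  have [dx dy] := dist 1%g _ tR; rewrite -f1 in dx dy.
  apply: (stable _ _ _ _ _ _ _ _ _ _ (w01 _ tR) (w01 _ tauR) dx dy du dv) => //.
  apply: (le_trans (scanD_pop_off m2 tauR _ _ _ tR ttau)).
  by rewrite ler_wpM2r// le_max lexx.
have [dx dy] := dist p _ tR.
apply: (stable _ _ _ _ _ _ _ _ _ _ (w01 _ tR) (w01 _ tauR) dx dy du dv) => //.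
apply: (le_trans (scanD_pop_balanced m2 tauR _ _ _ pB tR)).
by rewrite ler_wpM2r// le_max lexx orbT.
Qed.

(** * Concentration of the dissimilarities *)

Section SecondMoments.
Context {disp} {T : measurableType disp} {R : realType} (P : probability T R).
Implicit Types X Y : T -> R.

Lemma Lfun2_of_sqr X : measurable_fun setT X ->
  ('E_P[(fun t => X t ^+ 2)%R] < +oo)%E -> X \in Lfun P 2%:E.
Proof.
move=> mX; rewrite unlock => X2.
rewrite inE; apply/andP; split; first by rewrite inE.
rewrite inE/= /finite_norm unlock.
have E t : (`|(EFin \o X) t| `^ 2 = (X t ^+ 2)%:E)%E.
  by rewrite /= powR_mulrn// real_normK ?num_real.
by apply: poweR_lty; under eq_integral => t _ do rewrite E.
Qed.

Lemma covariance_suml (I : Type) (r : seq I) (X : I -> T -> R) Y :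
  (forall i, X i \in Lfun P 2%:E) -> Y \in Lfun P 2%:E ->
  covariance P (\sum_(i <- r) X i) Y = (\sum_(i <- r) covariance P (X i) Y)%E.
Proof.
move=> X2 Y2; elim: r => [|i r IH]; first by rewrite !big_nil covariance_cst_l.
rewrite !big_cons covarianceDl ?IH// rpred_sum// lee_fin ler1n//.
Qed.

Lemma variance_sum (d : nat) (X : 'I_d -> T -> R) :
  (forall i, X i \in Lfun P 2%:E) ->
  'V_P[(\sum_(i < d) X i)%R]%E = (\sum_(i < d) \sum_(j < d) covariance P (X i) (X j))%E.
Proof.
move=> X2; have S2 : \sum_(i < d) X i \in Lfun P 2%:E by rewrite rpred_sum// lee1n.
rewrite /variance covariance_suml//; apply: eq_bigr => i _.
rewrite covarianceC covariance_suml//.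
by apply: eq_bigr => j _; rewrite covarianceC.
Qed.

(** Cauchy-Schwarz also covers a vanishing variance: the correlation is then 0 by convention, but
    the covariance is at most 0 as well. *)
Lemma covariance_le_correlation X Y (C : R) :
  X \in Lfun P 2%:E -> Y \in Lfun P 2%:E ->
  ('V_P[X] <= C%:E)%E -> ('V_P[Y] <= C%:E)%E ->
  (covariance P X Y <= (`|correlation P X Y| * C)%:E)%E.
Proof.
move=> X2 Y2 VX VY.
have C0 : 0 <= C by rewrite -lee_fin (le_trans _ VX)// variance_ge0.
have Pfin : P setT \is a fin_num := fin_num_measure P _ measurableT.
have cfin : covariance P X Y \is a fin_num.
  by rewrite covariance_fin_num ?Lfun2_mul_Lfun1 ?Lfun_subset12.
have := covariance_le X2 Y2.
rewrite -sqrteM ?variance_ge0//.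
rewrite -(fineK cfin) -(fineK (variance_fin_num X2)) -(fineK (variance_fin_num Y2)).
rewrite -EFinM /= !lee_fin.
move: VX VY; rewrite -{1}(fineK (variance_fin_num X2)) -{1}(fineK (variance_fin_num Y2)).
rewrite !lee_fin /correlation => xC yC cs.
have sC : Num.sqrt (fine 'V_P[X]%E * fine 'V_P[Y]%E) <= C.
  rewrite -[leRHS](ger0_norm C0) -sqrtr_sqr ler_wsqrtr// expr2.
  by rewrite ler_pM// fine_ge0 ?variance_ge0.
move: cs sC; set c := fine (covariance P X Y); set s := Num.sqrt _ => cs sC.
have [s0|s0] := eqVneq s 0.
  by rewrite (le_trans cs)// s0 mulr_ge0.
rewrite -[leLHS](divfK s0).
apply: (le_trans (ler_norm _)); rewrite normrM ler_wpM2l//.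
by rewrite ger0_norm// sqrtr_ge0.
Qed.

Lemma variance_le_sqr X (C : R) : X \in Lfun P 2%:E ->
  ('E_P[(fun t => X t ^+ 2)%R] <= C%:E)%E -> ('V_P[X] <= C%:E)%E.
Proof.
move=> X2 XC; rewrite varianceE//.
have Efin : 'E_P[X]%E \is a fin_num.
  by rewrite expectation_fin_num// Lfun_subset12 ?fin_num_measure.
rewrite (le_trans _ XC)// leeBlDr ?fin_numX//.
rewrite leeDl// -(fineK Efin) -EFin_expe lee_fin sqr_ge0//.
Qed.

(** The variance of the sum splits into d diagonal terms, each at most [C], and off-diagonal
    covariances, bounded by [C] times the correlations. *)
Lemma chebyshev_mean (d : nat) (X : 'I_d -> T -> R) (C S e : R) :
  0 < e -> 0 <= C -> (forall q, measurable_fun setT (X q)) ->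
  (forall q, ('E_P[(fun t => X q t ^+ 2)%R] <= C%:E)%E) ->
  \sum_(q < d) \sum_(q' < d | q != q') `|correlation P (X q) (X q')| <= S ->
  (P [set t | (e <= `|d%:R^-1 * (\sum_(q < d) X q t)
                 - d%:R^-1 * (\sum_(q < d) fine 'E_P[X q]%E)|)%R]%classic <=
   (e ^- 2 * (d%:R^-1 ^+ 2 * (d%:R * C + S * C)))%:E)%E.
Proof.
move=> e0 C0 mX XC XS.
have X2 q : X q \in Lfun P 2%:E.
  by apply: Lfun2_of_sqr => //; rewrite (le_lt_trans (XC q))// ltry.
have X1 q : X q \in Lfun P 1 by rewrite Lfun_subset12 ?fin_num_measure.
have V q : ('V_P[X q] <= C%:E)%E by exact: variance_le_sqr.
pose Sf := \sum_(q < d) X q.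
have Sf2 : Sf \in Lfun P 2%:E by rewrite rpred_sum// lee1n.
have Sf1 : Sf \in Lfun P 1 by rewrite rpred_sum.
have SfE t : Sf t = \sum_(q < d) X q t by rewrite /Sf fct_sumE.
pose Yf : T -> R := d%:R^-1 \o* Sf.
have mS : measurable_fun setT Sf.
  rewrite (_ : Sf = fun t => \sum_(q < d) X q t); last exact/funext.
  exact: measurable_sum.
have mY : measurable_fun setT Yf by exact: measurable_funM.
pose Y : {RV P >-> R} := HB.pack_for {RV P >-> R} Yf (isMeasurableFun.Build _ _ _ _ Yf mY).
have YE t : Y t = d%:R^-1 * \sum_(q < d) X q t by rewrite -SfE mulrC.
have EY : fine 'E_P[Y]%E = d%:R^-1 * \sum_(q < d) fine 'E_P[X q]%E.
  rewrite expectationZl//.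
  have -> : 'E_P[Sf]%E = (\sum_(q < d) (fine 'E_P[X q])%:E)%E.
    rewrite /Sf -(big_map X xpredT id) expectation_sum.
      by rewrite big_map; apply: eq_bigr => q _; rewrite fineK// expectation_fin_num.
    by move=> _ /mapP[q _ ->].
  by rewrite sumEFin -EFinM.
have := chebyshev Y e0; rewrite EY => /le_trans cheb.
rewrite [X in P X](_ : _ =
  [set t | (e <= `|Y t - d%:R^-1 * \sum_(q < d) fine 'E_P[X q]%E|)%R]%classic); last first.
  by apply: eq_set => t; rewrite YE.
have VY : ('V_P[Y] <= (d%:R^-1 ^+ 2 * (d%:R * C + S * C))%:E)%E; last first.
  have step : ((e ^- 2)%:E * 'V_P[Y] <= (e ^- 2)%:E * (d%:R^-1 ^+ 2 * (d%:R * C + S * C))%:E)%E.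
    by apply (@lee_pmul R _ _ _ _) => //; rewrite ?variance_ge0// lee_fin invr_ge0 sqr_ge0.
  by apply: cheb; rewrite EFinM; exact: step.
rewrite varianceZ// (EFinM (d%:R^-1 ^+ 2)); apply (@lee_pmul R _ _ _ _) => //;
  rewrite ?lee_fin ?sqr_ge0 ?variance_ge0//.
rewrite variance_sum//.
have -> : (d%:R * C + S * C)%:E = ((\sum_(q < d) C) + S * C)%:E.
  by rewrite sumr_const card_ord mulr_natl.
apply: (@le_trans _ _ (\sum_(q < d) (C%:E +
   \sum_(q' < d | q != q') (`|correlation P (X q) (X q')| * C)%:E))%E).
  apply: lee_sum => q _; rewrite (bigD1 q)//= leeD//; first exact: V.
  under eq_bigl do rewrite eq_sym.
  by apply: lee_sum => q' _; exact: covariance_le_correlation.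
rewrite big_split/= sumEFin EFinD leeD2l//.
under eq_bigr do rewrite sumEFin -mulr_suml.
by rewrite sumEFin lee_fin -mulr_suml ler_wpM2r.
Qed.

End SecondMoments.

Lemma measurable_norm_far {disp} {T : measurableType disp} {R : realType}
    (f : T -> R) (mf : measurable_fun setT f) (c e : R) :
  measurable [set t | e < `|f t - c|] /\ measurable [set t | e <= `|f t - c|].
Proof.
have mg : measurable_fun setT (fun t => `|f t - c|).
  by apply: measurableT_comp => //; exact: measurable_funB.
split.
  rewrite (_ : [set t | _] = setT `&` (fun t => `|f t - c|) @^-1` `]e, +oo[).
    by apply: mg => //; exact: measurable_itv.
  by rewrite setTI; apply/seteqP; split => t; rewrite /= in_itv/= andbT.
rewrite (_ : [set t | _] = setT `&` (fun t => `|f t - c|) @^-1` `[e, +oo[).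
  by apply: mg => //; exact: measurable_itv.
by rewrite setTI; apply/seteqP; split => t; rewrite /= in_itv/= andbT.
Qed.

(** * Modulus of continuity, measurability and concentration for admissible pairs *)

Section Admissible.
Context {R : realType} (h psi : R -> R).
Hypothesis hadm : admissible h psi.

Let h0 : h 0 = 0. Proof. by case: hadm => -[]. Qed.

Let hge0 x : 0 <= x -> 0 <= h x.
Proof. by case: hadm => -[_ _ + _ _ _ _ x0]; apply; rewrite in_itv/= x0. Qed.

Let hmono x y : 0 <= x -> x <= y -> h x <= h y.
Proof.
case: hadm => -[_ _ _ + _ _ _ x0 xy]; apply => //.
  by rewrite in_itv/= x0.
by rewrite in_itv/= (le_trans x0).
Qed.

Let psige0 x : 0 <= x -> 0 <= psi x.
Proof. by case: hadm => _ [_ _ + _ _ _ x0]; apply; rewrite in_itv/= x0. Qed.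

Let psimono x y : 0 <= x -> x <= y -> psi x <= psi y.
Proof.
case: hadm => _ [_ _ _ + _ _ x0 xy]; apply => //.
  by rewrite in_itv/= x0.
by rewrite in_itv/= (le_trans x0).
Qed.

(** Concavity between the end points 0 and [y], with h(0) = 0. *)
Lemma concave_ge_chord x y : 0 <= x -> x <= y -> 0 < y -> x / y * h y <= h x.
Proof.
move=> x0 xy y0; have [_ _ + _] := hadm.
have t0 : 0 <= x / y by rewrite divr_ge0// ltW.
have t1 : x / y <= 1 by rewrite ler_pdivrMr// mul1r.
have t01 : Itv.spec (@Itv.num_sem R) (Itv.Real `[0%Z, 1%Z]) (x / y).
  by rewrite /= /Itv.num_sem/= in_itv/= num_real t0 t1.
move=> /(_ (Itv.mk t01) y 0); rewrite !inE /= !in_itv/= lexx (ltW y0) => /(_ isT isT).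
rewrite convRE/= h0 oppr0 mulr0 addr0 mulrN lerN2; set c := conv _ _ _.
suff -> : c = x by [].
by rewrite /c [LHS](convRE (R := R) y 0) /= mulr0 addr0 divfK ?gt_eqF.
Qed.

(** Sum of the chord bounds for [x] and [y] on the interval from 0 to x + y. *)
Lemma concave_subadditive x y : 0 <= x -> 0 <= y -> h (x + y) <= h x + h y.
Proof.
move=> x0 y0; have [->|xy0] := eqVneq (x + y) 0.
  by rewrite h0 addr_ge0// hge0.
have s0 : 0 < x + y by rewrite lt_neqAle eq_sym xy0 addr_ge0.
have -> : h (x + y) = x / (x + y) * h (x + y) + y / (x + y) * h (x + y).
  by field.
by rewrite lerD// concave_ge_chord// ?lerDl ?lerDr.
Qed.

Lemma concave_modulus x y : 0 <= x -> 0 <= y -> `|h x - h y| <= h `|x - y|.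
Proof.
wlog xy : x y / y <= x.
  move=> wl x0 y0; have [yx|/ltW xy] := leP y x; first exact: wl.
  by rewrite distrC (distrC x); exact: wl.
move=> x0 y0; rewrite !ger0_norm ?subr_ge0// ?hmono//.
by rewrite lerBlDr -{1}(subrK y x) concave_subadditive// subr_ge0.
Qed.

Lemma small_near0 (e : R) : 0 < e ->
  exists2 a : R, 0 < a & forall x, 0 <= x -> x < a -> h x < e.
Proof.
move=> e0; have [[hc _ _ _] _ _ _] := hadm.
have /subspace_continuousP/(_ 0) := hc.
rewrite /= in_itv/= lexx => /(_ isT) /cvgrPdist_lt /(_ e e0).
rewrite near_withinE => -[a /= a0 ha]; exists a => // x x0 xa.
have := ha x; rewrite /ball/= sub0r normrN ger0_norm// => /(_ xa).
rewrite in_itv/= x0 /from_subspace h0 sub0r normrN ger0_norm ?hge0//; exact.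
Qed.

(** Truncation at 0 turns a function monotone on the half-line into one monotone on R, hence Borel.
    It changes nothing at the nonnegative arguments that occur. *)
Let measurable_mono (f : R -> R) :
  (forall x y, 0 <= x -> x <= y -> f x <= f y) ->
  measurable_fun setT (fun x : R => f (Num.max x 0)).
Proof.
move=> fmono; apply: nondecreasing_measurable => // x y xy.
apply: fmono; first by rewrite le_max lexx orbT.
by rewrite ge_max !le_max xy lexx orbT.
Qed.

Lemma measurable_psi_coord (d : nat) (q : 'I_d) :
  measurable_fun setT (psi_coord psi q : d.-tuple R * d.-tuple R -> R).
Proof.
have -> : psi_coord psi q = (fun x => psi (Num.max x 0)) \o
    (fun z : d.-tuple R * d.-tuple R => `|tnth z.1 q - tnth z.2 q|).
  by apply/funext => z /=; rewrite /psi_coord max_l.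
apply: measurableT_comp; first exact: measurable_mono.
apply: measurableT_comp => //; apply: measurable_funB.
  by apply: (measurableT_comp (measurable_tnth q)); exact: measurable_fst.
by apply: (measurableT_comp (measurable_tnth q)); exact: measurable_snd.
Qed.

Lemma psi_coord_ge0 (d : nat) (q : 'I_d) (z : d.-tuple R * d.-tuple R) :
  0 <= psi_coord psi q z.
Proof. exact: psige0. Qed.

Lemma dissimE (d : nat) (z : d.-tuple R * d.-tuple R) :
  dissim h psi z.1 z.2 = h (d%:R^-1 * \sum_(q < d) psi_coord psi q z).
Proof. by []. Qed.

Lemma measurable_dissim (d : nat) :
  measurable_fun setT (fun z : d.-tuple R * d.-tuple R => dissim h psi z.1 z.2).
Proof.
have -> : (fun z => dissim h psi z.1 z.2) = (fun x => h (Num.max x 0)) \o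
    (fun z : d.-tuple R * d.-tuple R => d%:R^-1 * \sum_(q < d) psi_coord psi q z).
  apply/funext => z /=; rewrite dissimE max_l// mulr_ge0// sumr_ge0// => q _.
  exact: psi_coord_ge0.
apply: measurableT_comp; first exact: measurable_mono.
by apply: measurable_funM => //; apply: measurable_sum => q; exact: measurable_psi_coord.
Qed.

Lemma dissimC (d : nat) (x y : d.-tuple R) : dissim h psi x y = dissim h psi y x.
Proof.
by rewrite /dissim; congr (h (_ * _)); apply: eq_bigr => k _; rewrite distrC.
Qed.

Variables F G : forall d, probability (d.-tuple R) R.

Lemma measurable_dissim_far (d : nat) (c e : R) : measurable
  [set z : d.-tuple R * d.-tuple R | e < `|dissim h psi z.1 z.2 - c|].
Proof.
by have [] := measurable_norm_far (measurable_dissim (d := d)) c e.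
Qed.

(** If the coordinate average is within [a] of its mean, the modulus of continuity puts the
    dissimilarity within [e] of its population value. Chebyshev bounds the probability of the
    complement. *)
Lemma dissim_concentration (e eta : R) : A4_pair psi F G -> 0 < e -> 0 < eta ->
  \forall d \near \oo,
    ((F d \x G d)%E [set z | (e < `|dissim h psi z.1 z.2
        - pop_dissim h psi (F d) (G d)|)%R]%classic <= eta%:E)%E.
Proof.
move=> [[C XC] /eqoP So] e0 eta0.
have [a a0 ha] := small_near0 e0.
have {}XC d (q : 'I_d) : ('E_(F d \x G d)[(fun z => psi_coord psi q z ^+ 2)%R] <= `|C|%:E)%E.
  by rewrite (le_trans (XC d q))// lee_fin ler_norm.
(* For large d both 1/d and the sum of correlations divided by d^2 are at most [b], so Chebyshev
   gives at most a^-2 (2 b) |C|, and [b] makes this at most [eta]. *)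
pose b := a ^+ 2 * eta / (2 * (`|C| + 1)).
have C1 : 0 < `|C| + 1 by rewrite ltr_wpDl.
have b0 : 0 < b by rewrite divr_gt0 ?mulr_gt0// exprn_gt0.
near=> d.
have d0 : 0 < d%:R :> R by rewrite ltr0n; near: d; exists 1%N.
have db : d%:R^-1 <= b.
  rewrite -[leRHS]invrK lef_pV2 ?posrE ?invr_gt0//.
  by near: d; exact: nbhs_infty_ger.
have dS : \sum_(q < d) \sum_(q' < d | q != q')
    `|correlation (F d \x G d)%E (psi_coord psi q) (psi_coord psi q')| <= b * d%:R ^+ 2.
  apply: (le_trans (ler_norm _)); rewrite -[X in b * X]ger0_norm ?sqr_ge0//.
  by near: d; exact: So.
have mX q : measurable_fun setT (psi_coord psi q : d.-tuple R * d.-tuple R -> R).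
  exact: measurable_psi_coord.
have := chebyshev_mean a0 (normr_ge0 C) mX (XC d) dS.
move=> cheb; apply: (@le_trans _ _ (a ^- 2 * (d%:R^-1 ^+ 2 *
    (d%:R * `|C| + b * d%:R ^+ 2 * `|C|)))%:E); last first.
  rewrite lee_fin.
  have -> : a ^- 2 * (d%:R^-1 ^+ 2 * (d%:R * `|C| + b * d%:R ^+ 2 * `|C|)) =
      a ^- 2 * ((d%:R^-1 + b) * `|C|) by field; rewrite !gt_eqF.
  rewrite ler_pdivrMl ?exprn_gt0//.
  apply: (@le_trans _ _ ((b + b) * (`|C| + 1))).
    apply: ler_pM => //; first by rewrite addr_ge0 ?invr_ge0// ltW.
      by rewrite lerD2r.
    by rewrite lerDl.
  by rewrite /b le_eqVlt; apply/orP; left; apply/eqP; field; rewrite gt_eqF.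
apply: le_trans cheb; apply: le_measure; rewrite ?inE.
- exact: measurable_dissim_far.
- have mavg : measurable_fun setT (fun z : d.-tuple R * d.-tuple R =>
      d%:R^-1 * \sum_(q < d) psi_coord psi q z).
    by apply: measurable_funM => //; exact: measurable_sum.
  exact: (measurable_norm_far mavg _ a).2.
- move=> z /= far; rewrite leNgt; apply/negP => close.
  move: far; apply/negP; rewrite -leNgt ltW//.
  rewrite dissimE /pop_dissim; apply: le_lt_trans (concave_modulus _ _) _.
  + by rewrite mulr_ge0// sumr_ge0// => q _; exact: psi_coord_ge0.
  + rewrite mulr_ge0// sumr_ge0// => q _; rewrite fine_ge0// expectation_ge0// => z'.
    exact: psi_coord_ge0.
  + exact: ha.
Unshelve. all: by end_near. Qed.

End Admissible.

(** * Events and their probabilities *)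

Section Limit.
Context {R : realType}.

Lemma measure_bigsetU_le {disp} {T : measurableType disp} (P : probability T R)
    (I : Type) (r : seq I) (B : I -> set T) (e : R) :
  (forall i, measurable (B i)) -> (forall i, (P (B i) <= e%:E)%E) ->
  (P (\big[setU/set0]_(i <- r) B i) <= ((size r)%:R * e)%:E)%E.
Proof.
move=> mB PB; elim: r => [|i r IH]; first by rewrite big_nil measure0 mul0r.
rewrite big_cons; apply: le_trans (measureU2 _ _ _) _ => //.
  exact: bigsetU_measurable.
by rewrite /= -natr1 mulrDl mul1r addrC EFinD leeD.
Qed.

(** Union bound over a family of bad events whose number does not grow with d; the probability
    spaces may change with d. *)
Lemma cvg_probability1 (disp : nat -> measure_display)
    (T : forall d, measurableType (disp d)) (P : forall d, probability (T d) R)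
    (I : finType) (A : forall d, set (T d)) (B : I -> forall d, set (T d)) :
  (forall d, measurable (A d)) -> (forall i d, measurable (B i d)) ->
  (forall i (e : R), 0 < e -> \forall d \near \oo, (P d (B i d) <= e%:E)%E) ->
  (\forall d \near \oo, ~` A d `<=` \big[setU/set0]_(i <- enum I) B i d) ->
  (fun d => P d (A d)) @ \oo --> 1%E.
Proof.
move=> mA mB PB AB.
apply/fine_cvgP; split; first by apply: nearW => d; exact: fin_num_measure.
apply/cvgrPdist_le => e e0.
(* The successor keeps the divisor positive when [I] is empty. *)
pose eta := e / (size (enum I)).+1%:R.
have eta0 : 0 < eta by rewrite divr_gt0// ltr0n.
have near_all : \forall d \near \oo, forall i, i \in enum I -> (P d (B i d) <= eta%:E)%E.
  elim: (enum I) => [|i r IH]; first by apply: nearW.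
  near=> d => j; rewrite inE => /orP[/eqP ->|jr].
    by near: d; exact: PB.
  by move: j jr; near: d; exact: IH.
near=> d.
have le1 : (P d (~` A d) <= e%:E)%E.
  have PBd i : (P d (B i d) <= eta%:E)%E.
    by have : i \in enum I; [rewrite mem_enum|move: i; near: d].
  apply: (@le_trans _ _ (P d (\big[setU/set0]_(i <- enum I) B i d))).
    apply: le_measure; rewrite ?inE; [exact: measurableC|exact: bigsetU_measurable|].
    by near: d.
  apply: (le_trans (measure_bigsetU_le _ _ PBd)) => //.
  by rewrite lee_fin /eta mulrCA ger_pMr// ler_pdivrMr// mul1r ler_nat leqnSn.
rewrite /= ger0_norm; last first.
  by rewrite subr_ge0 -lee_fin fineK ?fin_num_measure// probability_le1.
rewrite -lee_fin EFinB fineK ?fin_num_measure//.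
by rewrite probability_setC in le1.
Unshelve. all: by end_near. Qed.

End Limit.

Section PairLaw.
Context {R : realType} {disp dispU} {T : measurableType disp}
  {U : measurableType dispU} (P : probability T R) (n : nat).

(** Independence identifies the joint law with the product measure on rectangles, and uniqueness of
    the product measure extends this to all measurable sets. *)
Lemma pair_law (X : 'I_n -> {RV P >-> U}) (F G : probability U R) (i j : 'I_n) :
  mutually_independent X -> i != j ->
  (forall A, measurable A -> distribution P (X i) A = F A) ->
  (forall A, measurable A -> distribution P (X j) A = G A) ->
  forall B, measurable B ->
    P [set w | B (X i w, X j w)] = (F \x G)%E B.
Proof.
move=> indep ij XF XG B mB.
have mXY : measurable_fun setT (fun w => (X i w, X j w)).
  by apply: measurable_fun_pair; exact: measurable_funPT.
pose XY : {RV P >-> (U * U)%type} := HB.pack_for {RV P >-> (U * U)%type}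
  (fun w => (X i w, X j w)) (isMeasurableFun.Build _ _ _ _ _ mXY).
rewrite (@product_measure_unique _ _ _ _ _ _ _ (distribution P XY))// => A C mA mC.
pose E k := if k == i then A else C.
have mE k : measurable (E k) by rewrite /E; case: ifP.
have Ei : E i = A by rewrite /E eqxx.
have Ej : E j = C by rewrite /E eq_sym (negbTE ij).
have indE := indep [set i; j]%SET E mE.
rewrite big_setU1 ?inE// big_set1 Ei Ej in indE.
have mXi k B' : measurable B' -> measurable (X k @^-1` B').
  by move=> mB'; rewrite -[X in measurable X]setTI; exact: measurable_funPT.
have mcap : measurable (\bigcap_(k in [set` [set i; j]%SET]) (X k @^-1` E k)).
  by apply: fin_bigcap_measurable => // k _; exact: mXi.
transitivity (F A * G C)%E; last by [].
rewrite -(XF _ mA) -(XG _ mC) /distribution /pushforward.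
rewrite -(fineK (fin_num_measure P _ (mXi i _ mA))) -(fineK (fin_num_measure P _ (mXi j _ mC))).
rewrite -EFinM -indE fineK ?fin_num_measure//; congr (P _).
apply/seteqP; split => w /=.
  move=> [wA wC] k /=; rewrite !inE => /orP[/eqP ->|/eqP ->].
    by rewrite Ei.
  by rewrite Ej.
move=> H; split; [rewrite -Ei|rewrite -Ej]; apply: H; rewrite /= !inE eqxx ?orbT//.
Qed.

End PairLaw.

(** * The permutation quantile and measurability of the detection event *)

Section Quantile.
Context {R : realType} (h psi : R -> R) (n m d : nat).
Implicit Type z : 'I_n -> d.-tuple R.

Lemma weight_Dn_ge0 z t : 0 <= weight n t * Dn h psi z t.
Proof. by rewrite mulr_ge0 ?weight_ge0 ?addr_ge0 ?sqr_ge0. Qed.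

Lemma Sn_ge0 z : 0 <= Sn h psi m z.
Proof. by rewrite /Sn; elim/big_rec: _ => // t x _ x0; rewrite le_max x0 orbT. Qed.

Lemma Sn_ge z t : in_range n m t -> weight n t * Dn h psi z t <= Sn h psi m z.
Proof.
move=> /andP[mt tm].
apply: (@le_bigmax_seq _ _ _ _ 0 t xpredT (fun t => weight n t * Dn h psi z t)) => //.
by rewrite mem_index_iota mt ltnS.
Qed.

Lemma Sn_lt z s : 0 < s ->
  (forall t, in_range n m t -> weight n t * Dn h psi z t < s) -> Sn h psi m z < s.
Proof.
move=> s0 ub; rewrite /Sn big_seq; apply: bigmax_lt => // t.
by rewrite mem_index_iota ltnS; exact: ub.
Qed.

(* The infimum over all real thresholds reduces to a finite condition, from
   which measurability of the detection event follows. *)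
Lemma perm_quantile_lt (alpha s : R) z : 0 < alpha < 1 ->
  (perm_quantile h psi m alpha z < s) <->
  (exists2 J : {set 'S_n}, 1 - alpha <= n`!%:R^-1 * #|J|%:R &
    forall p, p \in J -> Sn h psi m (fun i => z (p i)) < s).
Proof.
move=> /andP[a0 a1]; pose S (p : 'S_n) := Sn h psi m (fun i => z (p i)).
have S0 p : 0 <= S p by exact: Sn_ge0.
have count (x : R) : \sum_(p : 'S_n) (S p <= x)%R%:R = #|[set p | S p <= x]%SET|%:R :> R.
  rewrite -sum1_card natr_sum [RHS]big_mkcond; apply: eq_bigr => p _.
  by rewrite inE; case: (S p <= x).
have n0 : 0 < n`!%:R :> R by rewrite ltr0n fact_gt0.
rewrite /perm_quantile; set D := (X in inf X).
have lbD : has_lbound D by exists 0 => x [].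
split.
  move=> /inf_lt [].
    (* The largest permuted statistic is a feasible threshold, so the infimum is over a nonempty
       set. *)
    pose M := \big[Num.max/0]_(p : 'S_n) S p.
    have SM p : S p <= M by exact: le_bigmax.
    exists M; split; first exact: le_trans (SM 1%g).
    rewrite (eq_bigr (fun=> 1)) => [|p _]; last by rewrite SM.
    by rewrite sumr_const card_Sn mulVf ?gt_eqF// lerBlDr lerDl ltW.
  move=> x [x0]; rewrite count => ge xs; exists [set p | S p <= x]%SET => // p.
  by rewrite inE => /le_lt_trans; exact.
move=> [J cJ Js]; pose M := \big[Num.max/0]_(p in J) S p.
(* [J] is nonempty because 1 - alpha > 0. *)
have [p0 p0J] : exists p, p \in J.
  apply/set0Pn; apply/eqP => J0; move: cJ; rewrite J0 cards0 mulr0; lra.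
have s0 : 0 < s by apply: le_lt_trans (Js _ p0J); exact: Sn_ge0.
apply: (@le_lt_trans _ _ M); last by apply: bigmax_lt.
apply: ge_inf => //; split.
  by apply: le_trans (le_bigmax_cond _ _ p0J); exact: S0.
rewrite count (le_trans cJ)// ler_pM2l ?invr_gt0// ler_nat subset_leq_card//.
by apply/fintype.subsetP => p pJ; rewrite inE; exact: le_bigmax_cond.
Qed.

End Quantile.

Section MeasurableScan.
Context {R : realType} {disp} {T : measurableType disp} (h psi : R -> R).
Hypothesis hadm : admissible h psi.
Variables (n m d : nat) (z : 'I_n -> T -> d.-tuple R).
Hypothesis mz : forall i, measurable_fun setT (z i).

Let measurable_pair_sum (Q : rel 'I_n) : measurable_fun setT (fun w =>
  \sum_(i < n) \sum_(j < n | Q i j) dissim h psi (z i w) (z j w)).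
Proof.
apply: measurable_sum => i; under eq_fun do rewrite big_mkcond/=.
apply: measurable_sum => j; case: (Q i j) => //.
have mij : measurable_fun setT (fun w => (z i w, z j w)) by exact: measurable_fun_pair.
exact: (measurableT_comp (measurable_dissim hadm (d := d)) mij).
Qed.

Lemma measurable_Sn : measurable_fun setT (fun w => Sn h psi m (fun i => z i w)).
Proof.
have mT11 t : measurable_fun setT (fun w => T11 h psi (fun i => z i w) t).
  by apply: measurable_funM => //; exact: measurable_pair_sum.
have mT22 t : measurable_fun setT (fun w => T22 h psi (fun i => z i w) t).
  by apply: measurable_funM => //; exact: measurable_pair_sum.
have mT12 t : measurable_fun setT (fun w => T12 h psi (fun i => z i w) t).
  apply: measurable_funM => //.
  under eq_fun => w.
    rewrite (_ : \sum_(i < n | _) _ = \sum_(i < n) \sum_(j < n | (i < t)%N && (t <= j)%N)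
      dissim h psi (z i w) (z j w)); first by over.
    rewrite big_mkcond; apply: eq_bigr => i _; case: (i < t)%N => //.
    by rewrite big_pred0.
  exact: measurable_pair_sum.
rewrite /Sn; elim: (index_iota m _) => [|t r IH].
  by under eq_fun do rewrite big_nil; exact: measurable_cst.
under eq_fun do rewrite big_cons.
apply: measurable_maxr => //; apply: measurable_funM => //.
apply: measurable_funD; apply: measurable_funX; apply: measurable_funB.
- exact: mT12.
- exact: mT11.
- exact: mT12.
- exact: mT22.
Qed.

End MeasurableScan.

Lemma measurable_ltr_fun {disp} {T : measurableType disp} {R : realType} (f g : T -> R) :
  measurable_fun setT f -> measurable_fun setT g -> measurable [set t | f t < g t].
Proof.
move=> mf mg.
rewrite (_ : [set t | _] = setT `&` (g \- f) @^-1` `]0, +oo[).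
  by apply: (measurable_funB mg mf) => //; exact: measurable_itv.
by rewrite setTI; apply/seteqP; split => t; rewrite /= in_itv/= andbT subr_gt0.
Qed.

(** By [perm_quantile_lt] the event is a finite union, over large enough sets of permutations, of
    finite intersections of comparisons between scan statistics. *)
Lemma measurable_detection {disp} {T : measurableType disp} {R : realType}
    (h psi : R -> R) (n m d : nat) (z : 'I_n -> T -> d.-tuple R) (alpha : R) :
  admissible h psi -> (forall i, measurable_fun setT (z i)) -> 0 < alpha < 1 ->
  measurable [set w | perm_quantile h psi m alpha (fun i => z i w)
                      < Sn h psi m (fun i => z i w)].
Proof.
move=> hadm mz alpha01.
rewrite (_ : [set w | _] =
  \bigcup_(J in [set J : {set 'S_n} | 1 - alpha <= n`!%:R^-1 * #|J|%:R])
  \bigcap_(p in [set` J])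
    [set w | Sn h psi m (fun i => z ((p : 'S_n) i) w) < Sn h psi m (fun i => z i w)]).
  apply: fin_bigcup_measurable => // J _; apply: fin_bigcap_measurable => // p _.
  by apply: measurable_ltr_fun; exact: measurable_Sn.
apply/seteqP; split => w.
  move=> /(@perm_quantile_lt R h psi n m d alpha _ _ alpha01)[J cJ Js].
  by exists J => // p pJ; exact: Js.
move=> [J cJ Js]; apply/(@perm_quantile_lt R h psi n m d alpha _ _ alpha01).
by exists J => // p pJ; exact: Js.
Qed.

(** The balanced permutations make up a proportion at least 1 - alpha of all permutations, and each
    of their statistics lies strictly below the observed one. *)
Lemma detection_of_separation {R : realType} (h psi : R -> R) (n m tau d : nat)
    (alpha : R) (z : 'I_n -> d.-tuple R) :
  (2 <= m)%N -> in_range n m tau -> 0 < alpha < 1 ->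
  #|Bset n m tau (rho n m tau : R)|%:R / n`!%:R <= alpha ->
  (forall p : 'S_n, p \notin Bset n m tau (rho n m tau : R) ->
     forall t, in_range n m t ->
       weight n t * Dn h psi (fun i => z (p i)) t < weight n tau * Dn h psi z tau) ->
  perm_quantile h psi m alpha z < Sn h psi m z.
Proof.
move=> m2 tauR alpha01 Balpha sep.
apply/(@perm_quantile_lt R h psi n m d alpha _ _ alpha01).
have n0 : 0 < n`!%:R :> R by rewrite ltr0n fact_gt0.
exists (~: Bset n m tau (rho n m tau : R))%SET.
  rewrite lerBlDr -lerBlDl; apply: le_trans Balpha.
  rewrite cardsCs finset.setCK card_Sn natrB; last by rewrite -(card_Sn n) max_card.
  by rewrite mulrBr mulVf ?gt_eqF// subKr mulrC.
move=> p; rewrite inE => /sep {}sep.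
apply: Sn_lt => [|t tR].
  (* The maximum in [Sn] starts at 0, so [Sn_lt] needs a positive bound; it comes from the strict
     separation at [tau]. *)
  apply: lt_le_trans (Sn_ge _ _ _ tauR).
  by apply: le_lt_trans (sep tau tauR); exact: weight_Dn_ge0.
by apply: lt_le_trans (sep t tR) _; exact: Sn_ge.
Qed.

Theorem theorem3 (R : realType) (n m tau : nat) (delta : R)
    (h psi : R -> R)
    (F1 F2 : forall d : nat, probability (d.-tuple R) R)
    (disp : nat -> measure_display)
    (Omega : forall d : nat, measurableType (disp d))
    (P : forall d : nat, probability (Omega d) R)
    (Z : forall d : nat, 'I_n -> {RV (P d) >-> d.-tuple R})
    (That : forall d : nat, {RV (P d) >-> nat})
    (hdelta : 0 < delta < 1 / 2)
    (hm : m%:Z = Num.floor (n%:R * delta))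
    (hm2 : (2 <= m)%N)
    (htau : in_range n m tau)
    (hadm : admissible h psi)
    (hindep : forall d : nat, mutually_independent (Z d))
    (hZ1 : forall (d : nat) (i : 'I_n), (i < tau)%N ->
       forall A : set (d.-tuple R), measurable A ->
         distribution (P d) (Z d i) A = F1 d A)
    (hZ2 : forall (d : nat) (i : 'I_n), (tau <= i)%N ->
       forall A : set (d.-tuple R), measurable A ->
         distribution (P d) (Z d i) A = F2 d A)
    (hA4 : A4 psi F1 F2)
    (henergy : exists2 l : R, 0 < l &
       (fun d : nat => energy h psi (F1 d) (F2 d)) @ \oo --> l)
    (hThat : forall (d : nat) (w : Omega d),
       is_argmax h psi m (fun i => Z d i w) (That d w)) :
  ((fun d : nat => P d [set w | That d w = tau]) @ \oo --> 1%E) /\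
  (forall alpha : R, 0 < alpha < 1 ->
     #|Bset n m tau (rho n m tau : R)|%:R / n`!%:R <= alpha ->
     (fun d : nat => P d [set w | That d w = tau /\
        perm_quantile h psi m alpha (fun i => Z d i w)
          < Sn h psi m (fun i => Z d i w)]) @ \oo --> 1%E).
Proof.
case: henergy => l l0 cvl.
(* The energy is at least l/2 for all large d, and this fixes the radius [e] once and for all. *)
have l20 : 0 < l / 2 by rewrite divr_gt0.
have [e e0 sep] := scanD_separation hm2 htau l20.
pose f11 d := pop_dissim h psi (F1 d) (F1 d).
pose f12 d := pop_dissim h psi (F1 d) (F2 d).
pose f22 d := pop_dissim h psi (F2 d) (F2 d).
pose pop d := popmx (f11 d) (f12 d) (f22 d) (fun k : 'I_n => (k < tau)%N).
pose far (i j : 'I_n) d (xy : d.-tuple R * d.-tuple R) : Prop :=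
  e < `|dissim h psi xy.1 xy.2 - pop d i j|.
(* Bad events, one for each pair i < j; symmetry of the dissimilarity and of [popmx] takes care of j
   < i. *)
pose B (ij : 'I_n * 'I_n) d : set (Omega d) :=
  if (ij.1 < ij.2)%N then [set w | far ij.1 ij.2 d (Z d ij.1 w, Z d ij.2 w)] else set0.
have mZ d i : measurable_fun setT (Z d i) by exact: measurable_funPT.
have mfar i j d : measurable (far i j d) by exact: measurable_dissim_far.
have mB ij d : measurable (B ij d).
  rewrite /B; case: ifP => // _; rewrite -[X in measurable X]setTI.
  by apply: (measurable_fun_pair (mZ d ij.1) (mZ d ij.2)) => //; exact: mfar.
have PB ij (eta : R) : 0 < eta -> \forall d \near \oo, (P d (B ij d) <= eta%:E)%E.
  case: ij => i j eta0; have [ij|/negbTE ji] := boolP (i < j)%N; last first.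
    by apply: nearW => d; rewrite /B /= ji measure0 lee_fin ltW.
  have ij' : i != j by rewrite -val_eqE /= neq_ltn ij.
  have [A11 A12 _ A22] := hA4.
  have law d F G := @pair_law _ _ _ _ _ (P d) n (Z d) F G i j (hindep d) ij'.
  have [jt|tj] := ltnP j tau.
    have it := ltn_trans ij jt.
    near=> d; rewrite /B /= ij (law d _ _ (hZ1 d i it) (hZ1 d j jt) _ (mfar i j d)).
    rewrite /far /pop /popmx it jt; near: d.
    exact: (@dissim_concentration _ _ _ hadm F1 F1).
  have [it|ti] := ltnP i tau.
    near=> d; rewrite /B /= ij (law d _ _ (hZ1 d i it) (hZ2 d j tj) _ (mfar i j d)).
    rewrite /far /pop /popmx it (ltnNge j) tj; near: d.
    exact: (@dissim_concentration _ _ _ hadm F1 F2).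
  near=> d; rewrite /B /= ij (law d _ _ (hZ2 d i ti) (hZ2 d j tj) _ (mfar i j d)).
  rewrite /far /pop /popmx (ltnNge i) ti (ltnNge j) tj; near: d.
  exact: (@dissim_concentration _ _ _ hadm F2 F2).
have good : \forall d \near \oo, forall w,
    ~ (\big[setU/set0]_(ij <- enum {: 'I_n * 'I_n}) B ij d) w ->
    (forall t, in_range n m t -> t <> tau ->
      weight n t * Dn h psi (fun i => Z d i w) t <
      weight n tau * Dn h psi (fun i => Z d i w) tau) /\
    (forall p : 'S_n, p \notin Bset n m tau (rho n m tau : R) ->
     forall t, in_range n m t ->
      weight n t * Dn h psi (fun i => Z d (p i) w) t <
      weight n tau * Dn h psi (fun i => Z d i w) tau).
  near=> d => w notB.
  have le_energy : l / 2 <= 2 * f12 d - f11 d - f22 d.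
    near: d; apply: (cvgr_ge _ cvl); rewrite ltr_pdivrMr// ltr_pMr// ltr1n//.
  apply: (sep _ _ _ (fun i j => dissim h psi (Z d i w) (Z d j w)) le_energy).
  have lt_close (i j : 'I_n) : (i < j)%N ->
      `|dissim h psi (Z d i w) (Z d j w) - pop d i j| <= e.
    move=> ij; rewrite leNgt; apply/negP => far_ij; apply: notB.
    rewrite -bigcup_seq; exists (i, j); first by rewrite /= mem_enum.
    by rewrite /B /= ij.
  move=> i j; rewrite -val_eqE /= neq_ltn => /orP[|ji]; first exact: lt_close.
  by rewrite dissimC popmxC; exact: lt_close.
(* Off the bad events [tau] is the strict maximiser, so whichever maximiser [That] selects is
   [tau]. *)
have argmax_tau : \forall d \near \oo, forall w,
    ~ (\big[setU/set0]_(ij <- enum {: 'I_n * 'I_n}) B ij d) w -> That d w = tau.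
  apply: filterS good => d sepd w /sepd[sepT _]; have [tR tmax] := hThat d w.
  case: (eqVneq (That d w) tau) => // /eqP /(sepT _ tR).
  by rewrite ltNge tmax.
have mThat d : measurable [set w | That d w = tau].
  by rewrite -[X in measurable X]setTI; exact: (measurable_funPT (That d) measurableT [set tau]).
split=> [|alpha alpha01 Balpha].
  apply: (cvg_probability1 mThat mB PB); apply: filterS argmax_tau => d argd w /= Tw.
  by apply: contrapT => /argd.
apply: (@cvg_probability1 _ disp Omega P _ _ B _ mB PB).
  by move=> d; apply: measurableI => //; exact: measurable_detection.
apply: filterS2 argmax_tau good => d argd sepd w /= Tw.
apply: contrapT => notB; apply: Tw; split; first exact: argd.
by apply: (detection_of_separation hm2 htau alpha01 Balpha); have [] := sepd w notB.
Unshelve. all: by end_near. Qed.
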